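(* Let $G=(n,S,X)$ be a generic $(d_1\times\dots\times d_n)$-game. For each $i\in[n]$, let $$S_c^{(i)}:=\{k\in[d_i]\mid p_{-i,k}\neq 0\ \text{for some}\ p\in P_G\}$$ be the set of pure strategies of player $i$ that have positive marginal probability for some correlated equilibrium. Let $\tilde G$ be the subgame of $G$ with pure strategies $\tilde S=\prod_{i=1}^n S_c^{(i)}$. Then $P_G$ is affinely isomorphic to $P_{\tilde G}$, and $P_{\tilde G}$ is either full-dimensional or a singleton.
   Context: **Games.** A game $G=(n,S,X)$ (in normal form) consists of $n\ge 2$ players, finite nonempty sets $S^{(i)}$ of pure strategies for $i\in[n]=\{1,\dots,n\}$, with $S=\prod_{i=1}^n S^{(i)}$, and real payoff tensors $X=(X^{(1)},\dots,X^{(n)})$, where $X^{(i)}_{j_1,\dots,j_n}\in\mathbb{R}$ is the payoff of player $i$ when each player $i'$ plays $j_{i'}\in S^{(i')}$. Write $d_i=|S^{(i)}|$, identify $S^{(i)}=[d_i]$, put $D=\prod_{i=1}^n d_i$, and call $G$ a $(d_1\times\dots\times d_n)$-game. Standing assumption on the given game $G$: $d_i\ge 2$ for all $i$ (subgames may have players with a single strategy). Identify $\mathbb{R}^D=\bigotimes_{i=1}^n\mathbb{R}^{d_i}$ and let $\Delta_{D-1}\subseteq\mathbb{R}^D$ be the probability simplex. **Slices and linear forms.** For $p\in\mathbb{R}^D$, $i\in[n]$, $k\in[d_i]$, let $p_{-i,k}\in\mathbb{R}^{D/d_i}=\bigotimes_{i'\ne i}\mathbb{R}^{d_{i'}}$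 be the $k$-th slice of $p$ in the $i$-th direction, i.e. the tensor of entries $p_{j_1,\dots,j_{i-1},k,j_{i+1},\dots,j_n}$. For $k,\ell\in[d_i]$ define the linear form on $\mathbb{R}^{D/d_i}$ $$H^{X^{(i)}}_{k,\ell}(q)=\sum_{j\in\prod_{i'\neq i}[d_{i'}]}\bigl(X^{(i)}_{j_1,\dots,j_{i-1},k,j_{i+1},\dots,j_n}-X^{(i)}_{j_1,\dots,j_{i-1},\ell,j_{i+1},\dots,j_n}\bigr)\,q_j .$$ **Correlated equilibria.** $P_G\subseteq\Delta_{D-1}$ is the set of all $p\in\Delta_{D-1}$ (called correlated equilibria) satisfying the incentive constraints $H^{X^{(i)}}_{k,\ell}(p_{-i,k})\ge 0$ for all $i\in[n]$ and $k,\ell\in[d_i]$; it is a nonempty convex polytope. **Subgame.** A subgame of $G$ is a game $\tilde G=(n,\tilde S,\tilde X)$ with $\tilde S=\prod_i\tilde S^{(i)}$, $\emptyset\neq\tilde S^{(i)}\subseteq S^{(i)}$, and $\tilde X^{(i)}$ the restriction of $X^{(i)}$ to $\tilde S$. Its polytope $P_{\tilde G}$ is full-dimensional if it has dimension $|\tilde S|-1$. **Genericity.** Let $A_G$ be the matrix with $D$ columns whose rows are the coefficient vectors (in the variable $p\in\mathbb{R}^D$) of all linear forms $p\mapsto H^{X^{(i)}}_{k,\ell}(p_{-i,k})$ ($i\in[n]$, $k\neq\ell\in[d_i]$) and of all coordinate forms $p\mapsto p_{j_1,\dots,j_n}$. Its entries are polynomials in the payoffs. The game $G$ is generic if every $D\times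 D$ minor of $A_G$ that is not identically zero as a polynomial in the payoffs is nonzero at the payoff tuple $X$ of $G$. Two polytopes are affinely isomorphic if there is an affine bijection between their affine hulls mapping one polytope onto the other. *)

(* Defs.v *)
From HB Require Import structures.
From mathcomp Require Import all_boot all_order all_algebra.
From mathcomp Require Import boolp classical_sets functions reals.
From mathcomp Require Import mpoly.

Set Implicit Arguments.
Unset Strict Implicit.
Unset Printing Implicit Defensive.

Import Order.TTheory GRing.Theory Num.Theory.
Local Open Scope ring_scope.

Section Profiles.
Variables (n : nat) (S : 'I_n -> finType).

Definition profile : finType := {dffun forall i : 'I_n, S i}.

Definition others (i : 'I_n) : finType :=
  {dffun forall i' : {i' : 'I_n | i' != i}, S (val i')}.

(* The profile (j_1, .., j_(i-1), k, j_(i+1), .., j_n). *)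
Definition glue (i : 'I_n) (k : S i) (j : others i) : profile :=
  [ffun i' => match eqVneq i' i with
              | EqNotNeq e => ecast x (S x) (esym e) k
              | NeqNotEq ne => j (Sub i' ne)
              end].

Lemma glue_same i (k : S i) j : glue k j i = k.
Proof. by rewrite ffunE; case: eqVneq => [e|/eqP//]; rewrite eq_axiomK. Qed.

Lemma glue_other i (k : S i) j (i' : {i' : 'I_n | i' != i}) :
  glue k j (val i') = j i'.
Proof.
case: i' => x xi; rewrite ffunE; case: eqVneq => [e|ne] /=.
  by exfalso; move/eqP: (xi); apply.
by rewrite (bool_irrelevance ne xi).
Qed.

(* The linear forms are defined over an arbitrary commutative ring K, so as to
   be available both for real payoffs and for indeterminate payoffs. *)
Section Forms.
Variable K : comNzRingType.

Definition slice (p : {ffun profile -> K}) (i : 'I_n) (k : S i) :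
    {ffun others i -> K} :=
  [ffun j => p (glue k j)].

Definition incentive (Y : 'I_n -> {ffun profile -> K}) (i : 'I_n) (k l : S i)
    (q : {ffun others i -> K}) : K :=
  \sum_(j : others i) (Y i (glue k j) - Y i (glue l j)) * q j.

Definition deviation : finType :=
  {x : {i : 'I_n & (S i * S i)%type} | (tagged x).1 != (tagged x).2}.

Definition constraint : finType := (deviation + profile)%type.

Definition constraint_form (Y : 'I_n -> {ffun profile -> K}) (r : constraint)
    (p : {ffun profile -> K}) : K :=
  match r with
  | inl x => let k := (tagged (val x)).1 in let l := (tagged (val x)).2 in
             incentive Y k l (slice p k)
  | inr j => p j
  end.

(* The coefficient of the variable p_j in a linear form is the value of the
   form at the j-th standard basis tensor. *)
Definition constraint_mx (Y : 'I_n -> {ffun profile -> K}) :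
    'M[K]_(#|constraint|, #|profile|) :=
  \matrix_(r, c) constraint_form Y (enum_val r)
                   [ffun j => (j == enum_val c)%:R].

End Forms.

(* One variable for each entry of each of the n payoff tensors. *)
Definition npayoffs : nat := #|{: 'I_n * profile}|.

Definition indeterminate_payoffs (R : comNzRingType) (i : 'I_n) :
    {ffun profile -> {mpoly R[npayoffs]}} :=
  [ffun j => 'X_(enum_rank (i, j))].

End Profiles.

Section Affine.
Variable R : realType.

Definition affine_hull (E : lmodType R) (P : set E) : set E :=
  [set y | exists (m : nat) (a : 'I_m -> R) (x : 'I_m -> E),
     [/\ forall i, P (x i), \sum_i a i = 1 & y = \sum_i a i *: x i]]%classic.

Definition affine_on (E F : lmodType R) (A : set E) (f : E -> F) : Prop :=
  forall (m : nat) (a : 'I_m -> R) (x : 'I_m -> E),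
    (forall i, A (x i)) -> \sum_i a i = 1 ->
    f (\sum_i a i *: x i) = \sum_i a i *: f (x i).

Definition affinely_isomorphic (E F : lmodType R) (P : set E) (Q : set F) :
    Prop :=
  exists f : E -> F,
    [/\ set_bij (affine_hull P) (affine_hull Q) f,
        affine_on (affine_hull P) f
      & (f @` P = Q)%classic].

Definition has_dimension (E : vectType R) (P : set E) (m : nat) : Prop :=
  exists (x0 : E) (V : {vspace E}),
    \dim V = m /\ affine_hull P = [set x | x - x0 \in V]%classic.

End Affine.

Record game (R : realType) := Game {
  nplayers : nat;
  nplayers_ge2 : (2 <= nplayers)%N;
  strategy : 'I_nplayers -> finType;
  strategy_gt0 : forall i, (0 < #|strategy i|)%N;
  payoff : 'I_nplayers -> {ffun profile strategy -> R} }.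

Arguments strategy {R} g i.
Arguments payoff {R} g i.

Section Games.
Variable R : realType.

(* R^o is R seen as a module over itself, which makes the space of tensors a
   vector space over R. *)
Definition tensor (G : game R) : vectType R :=
  {ffun profile (strategy G) -> R^o}.

Definition probability_simplex (G : game R) : set (tensor G) :=
  [set p : tensor G | (forall j, 0 <= p j :> R) /\ \sum_j p j = 1]%classic.

Definition correlated_equilibria (G : game R) : set (tensor G) :=
  [set p : tensor G | probability_simplex p /\
     forall (i : 'I_(nplayers G)) (k l : strategy G i),
       0 <= incentive (K := R) (payoff G) k l (slice p k) :> R]%classic.

Arguments correlated_equilibria G _ : clear implicits.

Definition singleton_set (E : Type) (P : set E) : Prop :=
  exists p : E, P = [set p]%classic.

Section Subgame.
Variables (G : game R) (T : forall i, {set strategy G i}).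

Definition sub_strategy (i : 'I_(nplayers G)) : finType :=
  {k : strategy G i | k \in T i}.

Definition sub_profile (j : profile sub_strategy) : profile (strategy G) :=
  [ffun i => val (j i)].

Lemma sub_strategy_gt0 (T_neq0 : forall i, T i != finset.set0) i :
  (0 < #|sub_strategy i|)%N.
Proof. by rewrite card_sig card_gt0; apply: T_neq0. Qed.

Definition subgame (T_neq0 : forall i, T i != finset.set0) : game R :=
  @Game R (nplayers G) (nplayers_ge2 G) sub_strategy (sub_strategy_gt0 T_neq0)
    (fun i => [ffun j => payoff G i (sub_profile j)]).

End Subgame.

Definition full_dimensional (G : game R) : Prop :=
  has_dimension (correlated_equilibria G) #|profile (strategy G)|.-1.

Definition generic (G : game R) : Prop :=
  let Asym := constraint_mx (@indeterminate_payoffs _ (strategy G) R) in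
  let A := constraint_mx (payoff G) in
  forall rows : 'I_#|profile (strategy G)| -> 'I_#|constraint (strategy G)|,
    injective rows ->
    \det (rowsub rows Asym) != 0 -> \det (rowsub rows A) != 0.

Definition ce_strategies (G : game R) (i : 'I_(nplayers G)) :
    {set strategy G i} :=
  [set k | `[< exists2 p : tensor G,
                 correlated_equilibria G p & slice p k != 0 >]]%SET.

End Games.

Arguments correlated_equilibria {R} G _.

(* Main.v *)
(* Linear programming duality gives an equilibrium p and multipliers a_i(k,l) >= 0
   of the incentive constraints that are strictly complementary.  Read the a_i as
   jump rates of Markov chains.  Genericity makes the rank of the constraints
   tight at p constant near the given payoffs; differentiating this condition in
   all payoff directions shows that p is invariant under the jumps of every
   single player, and the same holds for every tensor complementary to a.  So the
   strategies used in equilibrium are the recurrent ones.  If a has no jumps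
   between distinct used strategies, every constraint of the subgame is slack at
   p, and the constraints dropped from G are implied by strict domination.
   Otherwise all the chains are irreducible on the used strategies (else two
   blocks of profiles would share a multiplier although their payoffs vary
   independently), and invariance leaves only one equilibrium. *)
From HB Require Import structures.
Require Import Defs.
From mathcomp Require Import all_boot all_order all_algebra.
From mathcomp Require Import boolp classical_sets functions reals.
From mathcomp Require Import mpoly.
From mathcomp Require Import ring.

Set Implicit Arguments.
Unset Strict Implicit.
Unset Printing Implicit Defensive.

Import Order.TTheory GRing.Theory Num.Theory.
Local Open Scope ring_scope.

(** Genericity is used only through [tight_flow_invariant]. A combination of incentive forms,
    rearranged by [gain_flow], is a sum of payoff entries times net flows of mass. For one fixed
    payoff tensor its vanishing is a single equation; in all payoff directions it forces every net
    flow to vanish, player by player. This is stronger than stationarity under all the jumps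
    together: it passes to the marginals, which become stationary for the single players, and to the
    product of the marginals, which is why the support of [p] is a box. The lemma holds for signed
    weights and signed tensors, and the connectedness argument depends on that: there it is applied
    to first-order variations of the multipliers and to arbitrary solutions of a linear system. *)

Section Farkas.

(** * Theorems of the alternative over an ordered field *)

Variable R : realFieldType.

(** Induction on the generators. If the separator [x0] of the tail fails at [h], all vectors are
    projected along [a h] onto the hyperplane orthogonal to [x0], and the induction hypothesis is
    applied to the projections. *)
Lemma farkas_seq (J : finType) (I : eqType) (s : seq I) (a : I -> J -> R)
    (b : J -> R) : uniq s ->
  (exists x : J -> R, (forall i, i \in s -> 0 <= \sum_j a i j * x j) /\
     \sum_j b j * x j < 0) \/
  (exists2 c : I -> R, (forall i, 0 <= c i) &
     forall j, b j = \sum_(i <- s) c i * a i j).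
Proof.
elim: s a b => [|h s IHs] a b => [_|/= /andP[hs us]].
  have [b0|/existsNP[j0 /eqP bj0]] := pselect (forall j, b j = 0).
    by right; exists (fun=> 0) => // j; rewrite big_nil b0.
  left; exists (fun j => - b j); split=> //.
  under eq_bigr do rewrite mulrN.
  rewrite sumrN oppr_lt0 (bigD1 j0) //=; apply: ltr_pwDl.
    by rewrite -expr2 exprn_even_gt0.
  by apply: sumr_ge0 => j _; rewrite -expr2 sqr_ge0.
have [|[c c0 cb]] := IHs a b us; last first.
  right; exists (fun i => if i == h then 0 else c i) => [i|j].
    by case: ifP.
  rewrite big_cons eqxx mul0r add0r cb; apply: eq_big_seq => i si.
  by case: eqP => // ih; rewrite -ih si in hs.
move=> [x0 [ax0 bx0]].
have [hx0|hx0] := leP 0 (\sum_j a h j * x0 j).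
  left; exists x0; split=> // i; rewrite inE => /orP[/eqP->//|]; exact: ax0.
set u := \sum_j a h j * x0 j in hx0.
have u0 : u != 0 by rewrite lt_eqF.
pose f (v : J -> R) := (\sum_j v j * x0 j) / u.
have dotB (v y : J -> R) (t : R) : \sum_j (v j - t * a h j) * y j =
    \sum_j v j * y j - t * \sum_j a h j * y j.
  by rewrite mulr_sumr -sumrB; apply: eq_bigr => j _; rewrite mulrBl mulrA.
have [|[c c0 cb]] := IHs (fun i j => a i j - f (a i) * a h j)
   (fun j => b j - f b * a h j) us.
  move=> [x [ax bx]]; left.
  pose t := (\sum_j a h j * x j) / u.
  exists (fun j => x j - t * x0 j).
  have dotx (v : J -> R) : \sum_j v j * (x j - t * x0 j) =
      \sum_j (v j - f v * a h j) * x j.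
    rewrite dotB /f /t.
    under eq_bigr do rewrite mulrBr mulrCA.
    by rewrite sumrB -mulr_sumr; field.
  split; last by rewrite dotx.
  move=> i; rewrite inE dotx => /orP[/eqP->|]; last exact: ax.
  by rewrite dotB /f -/u divff // mul1r subrr.
(* Undoing the projection collects the multiples of [a h]. Their total is nonnegative because [u] is
   negative, [b] is negative at [x0], and the tail vectors are nonnegative there. *)
right; exists (fun i => if i == h then f b - \sum_(i <- s) c i * f (a i) else c i).
  move=> i; case: eqP => // _; rewrite subr_ge0; apply: (@le_trans _ _ 0).
    rewrite big_seq; apply: sumr_le0 => k ks; rewrite mulr_ge0_le0 //.
    by rewrite mulr_ge0_le0 // ?ax0 // invr_le0 ltW.
  by rewrite mulr_le0 // ?invr_le0 ltW.
move=> j; rewrite big_cons eqxx.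
have -> : \sum_(i <- s) (if i == h then f b - \sum_(i0 <- s) c i0 * f (a i0) else c i)
     * a i j = \sum_(i <- s) c i * a i j.
  by apply: eq_big_seq => i si; case: eqP => // ih; rewrite -ih si in hs.
have := cb j; under eq_bigr do rewrite mulrBr mulrA.
rewrite sumrB -mulr_suml => /eqP; rewrite subr_eq => /eqP ->; ring.
Qed.

Lemma farkas (I J : finType) (a : I -> J -> R) (b : J -> R) :
  (exists x : J -> R, (forall i, 0 <= \sum_j a i j * x j) /\
     \sum_j b j * x j < 0) \/
  (exists2 c : I -> R, (forall i, 0 <= c i) &
     forall j, b j = \sum_i c i * a i j).
Proof.
have [[x [ax bx]]|[c c0 cb]] := farkas_seq a b (index_enum_uniq I).
  by left; exists x; split=> // i; apply: ax; rewrite mem_index_enum.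
by right; exists c.
Qed.

Lemma fredholm (I J : finType) (a : I -> J -> R) (b : J -> R) :
  (forall x : J -> R, (forall i, \sum_j a i j * x j = 0) ->
     \sum_j b j * x j = 0) ->
  exists c : I -> R, forall j, b j = \sum_i c i * a i j.
Proof.
move=> ab.
have [[x [ax bx]]|[c c0 cb]] :=
  farkas (fun si : bool * I => fun j => (-1) ^+ si.1 * a si.2 j) b.
  suff bx0 : \sum_j b j * x j = 0 by rewrite bx0 ltxx in bx.
  apply: ab => i; apply/eqP; rewrite eq_le; apply/andP; split.
    have := ax (true, i); under eq_bigr do rewrite -mulrA.
    by rewrite -mulr_sumr mulN1r oppr_ge0.
  have := ax (false, i); under eq_bigr do rewrite -mulrA.
  by rewrite -mulr_sumr mul1r.
exists (fun i => c (false, i) - c (true, i)) => j.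
transitivity (\sum_(s : bool) \sum_i c (s, i) * ((-1) ^+ s * a i j)).
  by rewrite cb pair_bigA; apply: eq_bigr => -[].
rewrite big_bool /= -big_split /=; apply: eq_bigr => i _.
by rewrite expr1 expr0; ring.
Qed.

End Farkas.

(** * Stationary vectors of finite jump chains *)

(* [a k l] is the rate of jumps from [k] to [l] of a continuous-time Markov
   chain; the rates [a k k] are irrelevant. *)
Section Stationary.
Variables (R : realFieldType) (V : finType).
Implicit Types (a : V -> V -> R) (u v : V -> R).

Definition stationary a v :=
  forall k, (\sum_l a k l) * v k = \sum_l a l k * v l.

Definition jump a : rel V := fun k l => 0 < a k l.

(** A maximum principle: a Farkas certificate against existence is a potential [u] with
    [\sum_m a k m * (u k - u m)] negative at every [k] of [T]. This fails where [u] is maximal on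
    [T], since jumps from [T] stay in [T]. *)
Lemma stationary_exists a (T : {set V}) : T != finset.set0 ->
  (forall k l, 0 <= a k l) -> (forall k l, k \in T -> l \notin T -> a k l = 0) ->
  exists v, [/\ forall k, 0 <= v k, forall k, k \notin T -> v k = 0,
     (exists k, 0 < v k) & stationary a v].
Proof.
move=> T0 a0 aT.
pose L k m : R := (m == k)%:R * (\sum_l a k l) - a k m.
have LE k (u : V -> R) : \sum_m u m * L k m = \sum_m a k m * (u k - u m).
  under eq_bigr do rewrite mulrBr mulrA mulrAC.
  rewrite sumrB (bigD1 k) //= eqxx mulr1 [X in _ + X - _]big1 ?addr0; last first.
    by move=> m /negPf->; rewrite mulr0.
  rewrite mulr_sumr -sumrB; apply: eq_bigr => m _; ring.
pose rows (r : V + V + bool * V) k : R := match r with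
  | inl (inl m) => (m == k)%:R
  | inl (inr m) => if m \in T then 0 else - (m == k)%:R
  | inr (s, m) => (-1) ^+ s * L k m end.
have dot1 (m : V) (x : V -> R) : \sum_k (m == k)%:R * x k = x m.
  by rewrite (bigD1 m) //= eqxx mul1r big1 ?addr0 // => k /negPf;
    rewrite eq_sym => ->; rewrite mul0r.
have [[x [ax bx]]|[c c0 cb]] := farkas rows (fun=> -1).
  have x0 k : 0 <= x k by have := ax (inl (inl k)); rewrite dot1.
  exists x; split=> //.
  - move=> k kT; apply/eqP; rewrite eq_le x0 andbT.
    have := ax (inl (inr k)); rewrite /= (negPf kT).
    by under eq_bigr do rewrite mulNr; rewrite sumrN dot1 oppr_ge0.
  - apply/not_existsP => xN; move: bx; apply/negP; rewrite -leNgt.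
    apply: sumr_ge0 => k _; rewrite mulN1r oppr_ge0 leNgt.
    by apply/negP => /xN.
  - move=> m; have LxE : \sum_k L k m * x k = (\sum_l a m l) * x m - \sum_l a l m * x l.
      under eq_bigr do rewrite mulrBl -mulrA.
      by rewrite sumrB (dot1 m (fun k => (\sum_l a k l) * x k)).
    have Lx0 : \sum_k L k m * x k = 0.
      apply/eqP; rewrite eq_le; apply/andP; split.
        have := ax (inr (true, m)); rewrite /= expr1.
        by under eq_bigr do rewrite -mulrA; rewrite -mulr_sumr mulN1r oppr_ge0.
      have := ax (inr (false, m)); rewrite /= expr0.
      by under eq_bigr do rewrite -mulrA; rewrite -mulr_sumr mul1r.
    by apply/eqP; rewrite -subr_eq0 -LxE Lx0.
have [k0 k0T] := set0Pn _ T0.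
pose u m := c (inr (false, m)) - c (inr (true, m)).
have [k kT kmax] := @arg_maxP _ _ _ k0 (mem T) u k0T.
have /eqP := cb k; rewrite big_sumType /= big_sumType /=.
have -> : \sum_(m : bool * V) c (inr m) * rows (inr m) k = \sum_m u m * L k m.
  transitivity (\sum_(s : bool) \sum_m c (inr (s, m)) * ((-1) ^+ s * L k m)).
    by rewrite pair_bigA; apply: eq_bigr => -[].
  rewrite big_bool /= -big_split /=; apply: eq_bigr => i _.
  by rewrite expr1 expr0 /u; ring.
rewrite LE lt_eqF //; apply: (@lt_le_trans _ _ 0); first by rewrite ltrN10.
rewrite !addr_ge0 ?sumr_ge0 // => m _.
- by rewrite mulr_ge0.
- case: ifP => mT; first by rewrite mulr0.
  by case: eqP => [mk|]; rewrite ?oppr0 ?mulr0 //; by move: mT; rewrite mk (kT : k \in T).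
- have [mT|mT] := boolP (m \in T); last by rewrite aT ?mul0r.
  by apply: mulr_ge0; rewrite ?a0 // subr_ge0; apply: (kmax m).
Qed.

Lemma stationary_gt0 a v k l : (forall k l, 0 <= a k l) ->
  (forall k, 0 <= v k) -> stationary a v -> jump a k l -> 0 < v k -> 0 < v l.
Proof.
move=> a0 v0 av kl vk; rewrite lt_neqAle v0 andbT eq_sym; apply/eqP => vl.
have /eqP := av l; rewrite vl mulr0 (bigD1 k) //= lt_eqF //.
by rewrite ltr_pwDl ?mulr_gt0 // sumr_ge0 // => m _; rewrite mulr_ge0.
Qed.

Lemma stationary_connect_gt0 a v k l : (forall k l, 0 <= a k l) ->
  (forall k, 0 <= v k) -> stationary a v -> connect (jump a) k l ->
  0 < v k -> 0 < v l.
Proof.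
move=> a0 v0 av /connectP[s]; elim: s k => [|m s IHs] k /=.
  by move=> _ -> //.
by case/andP=> km ms lE vk; apply: (IHs m) => //; exact: stationary_gt0 km vk.
Qed.

(* No mass flows out of the set of states reachable from [l], hence no mass
   flows in. *)
Lemma stationary_jumpC a v k l : (forall k l, 0 <= a k l) ->
  (forall k, 0 <= v k) -> stationary a v -> jump a k l -> 0 < v k ->
  connect (jump a) l k.
Proof.
move=> a0 v0 av kl vk; apply: contraT => nlk.
pose U := [pred m | connect (jump a) l m].
have out m p : U m -> ~~ U p -> a m p = 0.
  move=> Um Up; apply/eqP; rewrite eq_le a0 andbT leNgt; apply: contra Up => mp.
  exact: connect_trans Um (connect1 _).
have : \sum_(m | U m) (\sum_p a m p) * v m =
       \sum_(m | U m) \sum_p a p m * v p by apply: eq_bigr.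
have -> : \sum_(m | U m) (\sum_p a m p) * v m =
          \sum_(m | U m) \sum_(p | U p) a p m * v p.
  rewrite exchange_big /=; apply: eq_bigr => m Um.
  rewrite mulr_suml (bigID U) /= [X in _ + X]big1 ?addr0 // => p Up.
  by rewrite out ?mul0r.
under [RHS]eq_bigr do rewrite (bigID U) /=.
rewrite big_split /= => /eqP; rewrite -subr_eq0 opprD addNKr oppr_eq0.
rewrite (bigD1 l) ?connect0 //= (bigD1 k) //= gt_eqF //.
rewrite -addrA ltr_pwDl ?mulr_gt0 // addr_ge0 ?sumr_ge0 // => m _.
  by rewrite mulr_ge0.
by rewrite sumr_ge0 // => p _; rewrite mulr_ge0.
Qed.

Lemma stationary_connectC a v k l : (forall k l, 0 <= a k l) ->
  (forall k, 0 <= v k) -> stationary a v -> connect (jump a) k l -> 0 < v k ->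
  connect (jump a) l k.
Proof.
move=> a0 v0 av /connectP[s]; elim: s k => [|m s IHs] k /=.
  by move=> _ -> _; exact: connect0.
case/andP=> km ms lE vk; have vm := stationary_gt0 a0 v0 av km vk.
exact: connect_trans (IHs m ms lE vm) (stationary_jumpC a0 v0 av km vk).
Qed.

(** Subtracting from [u] the largest multiple of [v] below it leaves a nonnegative stationary vector
    with a zero in [C]; a positive value elsewhere in [C] would spread to that zero. *)
Lemma stationary_unique a u v (C : {set V}) : (forall k l, 0 <= a k l) ->
  stationary a u -> stationary a v ->
  (forall k, k \in C -> 0 < v k) -> (forall k, k \notin C -> v k = 0) ->
  (forall k, k \notin C -> u k = 0) ->
  {in C &, forall k l, connect (jump a) k l} ->
  exists c, forall k, u k = c * v k.
Proof.
move=> a0 au av vC vNC uNC conn.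
have [C0|/set0Pn[k0 k0C]] := eqVneq C finset.set0.
  by exists 0 => k; rewrite mul0r uNC // C0 inE.
have [k kC kmin] := @arg_minP _ _ _ k0 (mem C) (fun k => u k / v k) k0C.
pose c := u k / v k; exists c.
pose q l := u l - c * v l.
have q0 l : 0 <= q l.
  have [lC|lC] := boolP (l \in C); last by rewrite /q vNC // uNC // mulr0 subrr.
  by rewrite subr_ge0 -ler_pdivlMr ?vC //; exact: kmin.
have aq : stationary a q.
  move=> m; rewrite /q mulrBr au mulrCA av mulr_sumr -sumrB.
  by apply: eq_bigr => l _; rewrite mulrBr mulrCA.
have qk : q k = 0 by rewrite /q /c divfK ?subrr // gt_eqF // vC.
move=> l; apply/eqP; rewrite -subr_eq0 -/(q l) eq_le q0 andbT leNgt.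
have [lC|lC] := boolP (l \in C); last by rewrite /q vNC // uNC // mulr0 subrr ltxx.
apply/negP => ql; have := stationary_connect_gt0 a0 q0 aq (conn l k lC kC) ql.
by rewrite qk ltxx.
Qed.

End Stationary.

(** * Unilateral changes of a profile *)

Section Update.
Variables (n : nat) (S : 'I_n -> finType).
Implicit Types (i : 'I_n) (j : profile S).

Definition upd (j : profile S) i (l : S i) : profile S := [ffun i' => dfwith j l i'].

Lemma upd_same j i l : @upd j i l i = l.
Proof. by rewrite ffunE dfwith_in. Qed.

Lemma upd_other j i l i' : i' != i -> @upd j i l i' = j i'.
Proof. by move=> ii'; rewrite ffunE dfwith_out // eq_sym. Qed.

Lemma upd_id j i : upd j (j i) = j.
Proof.
apply/ffunP => i'; have [->|ii'] := eqVneq i' i; first exact: upd_same.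
exact: upd_other.
Qed.

Lemma upd_upd j i (k l : S i) : upd (upd j k) l = upd j l.
Proof.
apply/ffunP => i'; have [->|ii'] := eqVneq i' i; first by rewrite !upd_same.
by rewrite !upd_other.
Qed.

Lemma glue_eq i (k : S i) (o : @others n S i) (j : profile S) :
  (Defs.glue k o == j) = (k == j i) && (o == [ffun i' => j (val i')]).
Proof.
apply/eqP/andP => [<-|[/eqP-> /eqP->]].
  rewrite glue_same eqxx; split=> //; apply/eqP/ffunP => i'.
  by rewrite ffunE glue_other.
apply/ffunP => i'; have [->|ii'] := eqVneq i' i; first by rewrite glue_same.
by rewrite (Defs.glue_other _ _ (Sub i' ii')) ffunE.
Qed.

Lemma upd_glue i (k l : S i) (o : @others n S i) : upd (Defs.glue k o) l = Defs.glue l o.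
Proof.
apply/eqP; rewrite eq_sym glue_eq upd_same eqxx; apply/eqP/ffunP => i'.
by rewrite ffunE upd_other ?(valP i') // glue_other.
Qed.

Section Sums.
Variable K : nzRingType.

Lemma sum_glue i (k : S i) (F : profile S -> K) :
  \sum_(o : @others n S i) F (Defs.glue k o) = \sum_(j : profile S | j i == k) F j.
Proof.
rewrite (reindex_onto (Defs.glue k) (fun j => [ffun i' => j (val i')])) /=.
  apply: eq_bigl => o; rewrite glue_same eqxx /=; apply/esym/eqP/ffunP => i'.
  by rewrite ffunE glue_other.
by move=> j /eqP jk; apply/eqP; rewrite glue_eq jk !eqxx.
Qed.

(** Exchanging the new strategy [l] with the current one [j i] is an involution on the pairs
    [(j, l)]. *)
Lemma sum_upd_swap i (F : profile S -> S i -> K) :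
  \sum_j \sum_l F j l = \sum_(j : profile S) \sum_(l : S i) F (upd j l) (j i).
Proof.
rewrite !pair_bigA /= (reindex (fun x : profile S * S i => (upd x.1 x.2, x.1 i))) //=.
apply: onW_bij; apply: inv_bij => -[j l] /=.
by rewrite upd_upd upd_id upd_same.
Qed.

Lemma sum_own i (F : profile S -> S i -> K) :
  \sum_k \sum_(j : profile S | j i == k) F j k = \sum_j F j (j i).
Proof.
rewrite (exchange_big_dep xpredT) //=; apply: eq_bigr => j _.
by rewrite (big_pred1 (j i)) // => k; rewrite eq_sym.
Qed.

End Sums.
End Update.

(** * Incentive forms and the flows of mass dual to them *)

Section Forms.
Variables (n : nat) (S : 'I_n -> finType) (K : comNzRingType).
Implicit Types (Y Z : 'I_n -> {ffun profile S -> K}) (p : profile S -> K).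
Implicit Types (a : forall i, S i -> S i -> K).

(* The value of the linear form H^{Y^(i)}_{k,l} at the slice p_{-i,k}. *)
Definition regret Y p i (k l : S i) : K :=
  \sum_(j : profile S | j i == k) (Y i j - Y i (upd j l)) * p j.

Lemma incentiveE Y (p : {ffun profile S -> K}) i (k l : S i) :
  incentive Y k l (slice p k) = regret Y p k l.
Proof.
rewrite /regret -sum_glue; apply: eq_bigr => o _.
by rewrite ffunE upd_glue.
Qed.

Lemma eq_regret Y p q i (k l : S i) : p =1 q -> regret Y p k l = regret Y q k l.
Proof. by move=> pq; apply: eq_bigr => j _; rewrite pq. Qed.

Lemma regret_diag Y p i (k : S i) : regret Y p k k = 0.
Proof.
by rewrite /regret big1 // => j /eqP <-; rewrite upd_id subrr mul0r.
Qed.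

(* The coefficient of the variable p_j in the combination of the incentive
   forms with weights [a]. *)
Definition gain Y a (j : profile S) : K :=
  \sum_i \sum_l a i (j i) l * (Y i j - Y i (upd j l)).

Lemma sum_regret Y a p :
  \sum_i \sum_k \sum_l a i k l * regret Y p k l = \sum_j gain Y a j * p j.
Proof.
under [RHS]eq_bigr do rewrite mulr_suml.
rewrite [RHS]exchange_big /=; apply: eq_bigr => i _.
rewrite -(sum_own (fun (j : profile S) k => (\sum_l a i k l * (Y i j - Y i (upd j l))) * p j)).
apply: eq_bigr => k _.
under eq_bigr do rewrite mulr_sumr.
rewrite exchange_big /=; apply: eq_bigr => j _; rewrite mulr_suml.
by apply: eq_bigr => l _; rewrite mulrA.
Qed.

Definition flow_invariant a p := forall i (j : profile S),
  (\sum_l a i (j i) l) * p j = \sum_k a i k (j i) * p (upd j k).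

(** Summation by parts: the payoff differences are moved onto the mass, so that each payoff entry is
    multiplied by the net outflow that the jumps of its owner cause at that profile. *)
Lemma gain_flow Y a p : \sum_j gain Y a j * p j =
  \sum_i \sum_(j : profile S) Y i j *
    ((\sum_l a i (j i) l) * p j - \sum_k a i k (j i) * p (upd j k)).
Proof.
under eq_bigr do rewrite mulr_suml.
rewrite exchange_big /=; apply: eq_bigr => i _.
have -> : \sum_(j : profile S) Y i j *
    ((\sum_l a i (j i) l) * p j - \sum_k a i k (j i) * p (upd j k)) =
    \sum_(j : profile S) \sum_(l : S i) Y i j * (a i (j i) l * p j) -
    \sum_(j : profile S) \sum_(k : S i) Y i j * (a i k (j i) * p (upd j k)).
  rewrite -sumrB; apply: eq_bigr => j _.
  by rewrite mulrBr mulr_suml !mulr_sumr.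
have -> : \sum_(j : profile S) \sum_(k : S i) Y i j * (a i k (j i) * p (upd j k)) =
    \sum_(j : profile S) \sum_(l : S i) Y i (upd j l) * (a i (j i) l * p j).
  rewrite [RHS]sum_upd_swap; apply: eq_bigr => j _; apply: eq_bigr => k _.
  by rewrite upd_upd upd_id upd_same.
rewrite -sumrB; apply: eq_bigr => j _; rewrite mulr_suml -sumrB.
by apply: eq_bigr => l _; ring.
Qed.

Lemma flow_invariant_gain Y a p : flow_invariant a p ->
  \sum_j gain Y a j * p j = 0.
Proof.
move=> ap; rewrite gain_flow big1 // => i _; rewrite big1 // => j _.
by rewrite ap subrr mulr0.
Qed.

Lemma gain_flow_invariant a p :
  (forall Z, \sum_j gain Z a j * p j = 0) -> flow_invariant a p.
Proof.
move=> aZ i j; apply/eqP; rewrite -subr_eq0; apply/eqP.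
have := aZ (fun i' => [ffun j' => ((i' == i) && (j' == j))%:R]).
rewrite gain_flow (bigD1 i) //= [X in _ + X = 0]big1 ?addr0; last first.
  move=> i' /negPf ii'; rewrite big1 // => j' _.
  by rewrite ffunE ii' mul0r.
rewrite (bigD1 j) //= [X in _ + X = 0]big1 ?addr0; last first.
  by move=> j' /negPf jj'; rewrite ffunE jj' andbF mul0r.
by rewrite ffunE !eqxx mul1r.
Qed.

End Forms.

(** * Existence of equilibria and of strictly complementary multipliers *)

Section Duality.
Variables (R : realFieldType) (n : nat) (S : 'I_n -> finType).
Variable X : 'I_n -> {ffun profile S -> R}.
Implicit Types (T : forall i, {set S i}) (p : profile S -> R).
Implicit Types (a : forall i, S i -> S i -> R).

Definition box T : pred (profile S) := fun j => [forall i, j i \in T i].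

Lemma regretE p i (k l : S i) : regret X p k l =
  \sum_(j : profile S) (j i == k)%:R * (X i j - X i (upd j l)) * p j.
Proof.
by rewrite /regret big_mkcond; apply: eq_bigr => j _; case: eqP => _;
  rewrite ?mul1r ?mul0r.
Qed.

Lemma gain_dev a (j : profile S) : gain X a j =
  \sum_(d : {i : 'I_n & (S i * S i)%type})
    a (tag d) (tagged d).1 (tagged d).2 *
    ((j (tag d) == (tagged d).1)%:R * (X (tag d) j - X (tag d) (upd j (tagged d).2))).
Proof.
transitivity (\sum_i \sum_(x : S i * S i) a i x.1 x.2 *
    ((j i == x.1)%:R * (X i j - X i (upd j x.2)))); last by rewrite sig_big_dep.
apply: eq_bigr => i _.
rewrite -(pair_bigA _ (fun k l => a i k l *
    ((j i == k)%:R * (X i j - X i (upd j l))))) /=.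
rewrite [RHS](bigD1 (j i)) //= [X in _ + X]big1 ?addr0.
  by apply: eq_bigr => l _; rewrite eqxx mul1r.
by move=> k /negPf kj; rewrite big1 // => l _; rewrite eq_sym kj mul0r mulr0.
Qed.

Lemma product_flow_invariant a (v : forall i, S i -> R) :
  (forall i, stationary (a i) (v i)) ->
  flow_invariant a (fun j => \prod_i v i (j i)).
Proof.
move=> av i j; rewrite (bigD1 i) //= mulrA av mulr_suml.
apply: eq_bigr => k _; rewrite -mulrA (bigD1 i (P := xpredT)) //= upd_same.
congr (_ * (_ * _)); apply: eq_bigr => i' ii'.
by rewrite upd_other.
Qed.

(* Hart and Schmeidler: a dual certificate of non-existence would be
   contradicted by the product of stationary distributions of the deviation
   rates it consists of. *)
Lemma equilibrium_exists T : (forall i, T i != finset.set0) ->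
  exists p : profile S -> R, [/\ forall j, 0 <= p j,
    forall j, ~~ box T j -> p j = 0, 0 < \sum_j p j
  & forall i k l, k \in T i -> l \in T i -> 0 <= regret X p k l].
Proof.
move=> T0.
pose rows (r : profile S + profile S + {i : 'I_n & (S i * S i)%type}) j : R :=
  match r with
  | inl (inl j') => (j' == j)%:R
  | inl (inr j') => if box T j' then 0 else - (j' == j)%:R
  | inr d => let: (k, l) := tagged d in
      if (k \in T (tag d)) && (l \in T (tag d)) then
        (j (tag d) == k)%:R * (X (tag d) j - X (tag d) (upd j l)) else 0
  end.
have dot1 (j : profile S) (x : profile S -> R) : \sum_j' (j == j')%:R * x j' = x j.
  rewrite (bigD1 j) //= eqxx mul1r big1 ?addr0 // => j' /negPf.
  by rewrite eq_sym => ->; rewrite mul0r.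
have [[p [ap bp]]|[c c0 cb]] := farkas rows (fun=> -1).
  have p0 j : 0 <= p j by have := ap (inl (inl j)); rewrite dot1.
  exists p; split=> //.
  - move=> j jT; apply/eqP; rewrite eq_le p0 andbT.
    have := ap (inl (inr j)); rewrite /= (negPf jT).
    by under eq_bigr do rewrite mulNr; rewrite sumrN dot1 oppr_ge0.
  - by move: bp; under eq_bigr do rewrite mulN1r; rewrite sumrN oppr_lt0.
  - move=> i k l kT lT; have := ap (inr (Tagged _ (k, l))).
    by rewrite /= kT lT regretE.
(* Cutting the weights off outside [T] makes [T] closed under the jumps, so that stationary vectors
   supported in [T] exist. *)
pose a i (k l : S i) : R :=
  if (k \in T i) && (l \in T i) then c (inr (Tagged _ (k, l))) else 0.
have a0 i k l : 0 <= a i k l by rewrite /a; case: ifP.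
have /fin_all_exists[v vP] (i : 'I_n) : exists v : S i -> R,
   [/\ forall k, 0 <= v k, forall k, k \notin T i -> v k = 0,
     (exists k, 0 < v k) & stationary (a i) v].
  by apply: stationary_exists => // k l kT lT; rewrite /a (negPf lT) andbF.
pose p (j : profile S) := \prod_i v i (j i).
have p0 j : 0 <= p j by apply: prodr_ge0 => i _; have [] := vP i.
have pT j : ~~ box T j -> p j = 0.
  rewrite negb_forall => /existsP[i iT]; have [_ v0 _ _] := vP i.
  by rewrite /p (bigD1 i) //= v0 ?mul0r.
have flow : flow_invariant a p.
  by apply: product_flow_invariant => i; have [] := vP i.
have /fin_all_exists[w wP] (i : 'I_n) : exists k, 0 < v i k by have [] := vP i.
have : 0 < \sum_j p j.
  rewrite (bigD1 ([ffun i => w i] : profile S)) //= ltr_pwDl ?sumr_ge0 //.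
  by apply: prodr_gt0 => i _; rewrite ffunE.
(* The certificate bounds [gain X a] above by -1 on the box, whereas its sum against the
   flow-invariant [p] is 0. *)
suff : \sum_j p j <= 0 by move=> /le_lt_trans h /h; rewrite ltxx.
have -> : \sum_j p j = - \sum_j (-1 - gain X a j) * p j.
  under [in RHS]eq_bigr do rewrite mulrBl mulN1r.
  by rewrite sumrB flow_invariant_gain // subr0 sumrN opprK.
rewrite oppr_le0; apply: sumr_ge0 => j _.
have [jT|jT] := boolP (box T j); last by rewrite pT // mulr0.
apply: mulr_ge0 => //; rewrite subr_ge0 (cb j) !big_sumType /=.
rewrite gain_dev -[leLHS]add0r lerD //; last first.
  apply: ler_sum => -[i [k l]] _ /=; rewrite /a; case: ifP => //.
  by rewrite mul0r mulr0.
rewrite addr_ge0 ?sumr_ge0 // => j' _; first by rewrite mulr_ge0.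
case: ifP => j'T; first by rewrite mulr0.
by case: eqP => [jj|]; rewrite ?oppr0 ?mulr0 //; move: j'T; rewrite jj jT.
Qed.

(** For each row [i0], the Farkas alternative for [- A i0] gives either a feasible vector strict at
    [i0], or a nonnegative relation between the rows in which [i0] has positive weight. Summing over
    all [i0] achieves strictness everywhere at once. *)
Lemma tucker (I J : finType) (A : I -> J -> R) : exists (x : J -> R) (c : I -> R),
  [/\ forall i, 0 <= \sum_j A i j * x j, forall i, 0 <= c i,
      forall j, \sum_i c i * A i j = 0
    & forall i, 0 < c i \/ 0 < \sum_j A i j * x j].
Proof.
have /fin_all_exists2[x x0 xP] (i0 : I) : exists2 xc : (J -> R) * (I -> R),
  [/\ forall i, 0 <= \sum_j A i j * xc.1 j, forall i, 0 <= xc.2 i &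
      forall j, \sum_i xc.2 i * A i j = 0] &
   0 < xc.2 i0 \/ 0 < \sum_j A i0 j * xc.1 j.
  have [[x [Ax bx]]|[c c0 cb]] := farkas A (fun j => - A i0 j).
    exists (x, fun=> 0) => /=; last first.
      by right; rewrite -oppr_lt0 -sumrN; under eq_bigr do rewrite -mulNr.
    by split=> // j; rewrite big1 // => i _; rewrite mul0r.
  exists (fun=> 0, fun i => c i + (i == i0)%:R) => /=; last first.
    by left; rewrite eqxx ltr_wpDl.
  split=> [i|i|j]; first by rewrite big1 // => j _; rewrite mulr0.
    by rewrite addr_ge0.
  under eq_bigr do rewrite mulrDl.
  rewrite big_split /= -cb (bigD1 i0) //= eqxx mul1r big1 ?addr0 ?addNr //.
  by move=> i /negPf->; rewrite mul0r.
exists (fun j => \sum_i (x i).1 j), (fun i' => \sum_i (x i).2 i').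
have dot i : \sum_j A i j * \sum_i' (x i').1 j =
    \sum_i' \sum_j A i j * (x i').1 j.
  by under eq_bigr do rewrite mulr_sumr; rewrite exchange_big.
split=> [i|i|j|i].
- by rewrite dot sumr_ge0 // => i' _; have [] := x0 i'.
- by rewrite sumr_ge0 // => i' _; have [] := x0 i'.
- under eq_bigr do rewrite mulr_suml.
  by rewrite exchange_big big1 // => i' _; have [] := x0 i'.
- case: (xP i) => xi; [left|right].
    by rewrite (bigD1 i) //= ltr_pwDl // sumr_ge0 // => i' _; have [] := x0 i'.
  rewrite dot (bigD1 i) //= ltr_pwDl // sumr_ge0 // => i' _.
  by have [] := x0 i'.
Qed.

Lemma regretD p q i (k l : S i) :
  regret X (fun j => p j + q j) k l = regret X p k l + regret X q k l.
Proof. by rewrite -big_split; apply: eq_bigr => j _; rewrite mulrDr. Qed.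

Lemma regretZ c p i (k l : S i) :
  regret X (fun j => c * p j) k l = c * regret X p k l.
Proof. by rewrite mulr_sumr; apply: eq_bigr => j _; rewrite mulrCA. Qed.

Lemma strict_complementarity : (forall i, (0 < #|S i|)%N) ->
  exists p a,
  [/\ forall j, 0 <= p j, 0 < \sum_j p j & forall i k l, 0 <= @regret _ _ _ X p i k l] /\
  [/\ forall i k l, 0 <= a i k l, forall j, gain X a j <= 0,
      forall i k l, 0 < a i k l \/ 0 < @regret _ _ _ X p i k l &
      forall j, 0 < p j \/ gain X a j < 0].
Proof.
move=> S0.
have [i|q [q0 _ qs qX]] := @equilibrium_exists (fun i => [set: S i]).
  by rewrite -card_gt0 cardsT.
pose A (r : {i : 'I_n & (S i * S i)%type} + profile S) (j : profile S) : R :=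
  match r with
  | inl d => (j (tag d) == (tagged d).1)%:R *
      (X (tag d) j - X (tag d) (upd j (tagged d).2))
  | inr j' => (j' == j)%:R
  end.
have dot1 (j : profile S) (x : profile S -> R) : \sum_j' (j == j')%:R * x j' = x j.
  rewrite (bigD1 j) //= eqxx mul1r big1 ?addr0 // => j' /negPf.
  by rewrite eq_sym => ->; rewrite mul0r.
have [x [c [Ax c0 cA xc]]] := tucker A.
have dotA i (k l : S i) : \sum_j A (inl (Tagged _ (k, l))) j * x j = regret X x k l.
  by rewrite regretE.
pose a i (k l : S i) : R := c (inl (Tagged _ (k, l))).
have gc j : gain X a j = - c (inr j).
  apply/eqP; rewrite -addr_eq0 -(cA j) big_sumType /= gain_dev; apply/eqP.
  congr (_ + _); first by apply: eq_bigr => -[i [k l]].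
  rewrite (bigD1 j) //= eqxx mulr1 big1 ?addr0 //.
  by move=> j' /negPf->; rewrite mulr0.
(* The vector [x] could be zero. Adding the equilibrium tensor [q] makes the total mass positive and
   keeps every strict inequality. *)
exists (fun j => x j + q j), a; split; split.
- by move=> j; rewrite addr_ge0 //; have := Ax (inr j); rewrite dot1.
- rewrite big_split /= ltr_wpDl // sumr_ge0 // => j _.
  by have := Ax (inr j); rewrite dot1.
- by move=> i k l; rewrite regretD addr_ge0 ?qX ?inE // -dotA.
- by move=> i k l; exact: c0.
- by move=> j; rewrite gc oppr_le0.
- move=> i k l; have [|rx] := xc (inl (Tagged _ (k, l))); first by left.
  by right; rewrite regretD ltr_pwDl ?qX ?inE // -dotA.
- move=> j; have [cj|] := xc (inr j); first by right; rewrite gc oppr_lt0.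
  by left; rewrite ltr_pwDl // -[X in _ < X](dot1 j).
Qed.

Definition tight a p := (forall i k l, a i k l * regret X p k l = 0) /\
  forall j, gain X a j * p j = 0.

(** Weak duality: by [sum_regret] the two families of terms have the same sum, and their signs are
    opposite, so every term is zero. *)
Lemma complementary a p : (forall i k l, 0 <= a i k l * regret X p k l) ->
  (forall j, gain X a j * p j <= 0) -> tight a p.
Proof.
move=> ap gp; have s0 : \sum_i \sum_k \sum_l a i k l * regret X p k l = 0.
  apply/eqP; rewrite eq_le; apply/andP; split.
    by rewrite sum_regret sumr_le0.
  by do 3 (apply: sumr_ge0 => ? _).
split.
  move=> i k l; apply/eqP; rewrite eq_le ap andbT -s0.
  rewrite (bigD1 i) //= (bigD1 k) //= (bigD1 l) //= -!addrA lerDl.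
  rewrite !addr_ge0 // ?sumr_ge0 // => ? _; first by rewrite sumr_ge0.
  by do 2 (apply: sumr_ge0 => ? _).
move=> j; apply/eqP; rewrite eq_le gp /= -s0 sum_regret (bigD1 j) //= gerDl.
by rewrite sumr_le0.
Qed.

End Duality.

(** * The constraint matrix and the use of genericity *)

Section ConstraintMatrix.
Variables (n : nat) (S : 'I_n -> finType).

Lemma constraint_formE (K : comNzRingType) (Y : 'I_n -> {ffun profile S -> K})
    (r : constraint S) (p : {ffun profile S -> K}) :
  constraint_form Y r p = match r with
    | inl x => regret Y p (tagged (val x)).1 (tagged (val x)).2
    | inr j => p j
    end.
Proof. by case: r => [x|j] //=; rewrite incentiveE. Qed.

Lemma constraint_mx_mul (K : comNzRingType) (Y : 'I_n -> {ffun profile S -> K})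
    (p : profile S -> K) r :
  \sum_c constraint_mx Y r c * p (enum_val c) =
  constraint_form Y (enum_val r) [ffun j => p j].
Proof.
have dot1 (j : profile S) : \sum_(c < #|profile S|) (j == enum_val c)%:R * p (enum_val c) = p j.
  rewrite (bigD1 (enum_rank j)) //= enum_rankK eqxx mul1r big1 ?addr0 //.
  move=> c cj; case: eqP => [jc|]; last by rewrite mul0r.
  by rewrite jc enum_valK eqxx in cj.
rewrite constraint_formE; under eq_bigr do rewrite mxE constraint_formE.
case: (enum_val r) => [x|j]; last by under eq_bigr do rewrite ffunE; rewrite ffunE dot1.
under eq_bigr do rewrite mulr_suml.
rewrite exchange_big /=; apply: eq_bigr => j _.
under eq_bigr do rewrite ffunE -mulrA.
by rewrite -mulr_sumr dot1 ffunE.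
Qed.

Lemma map_constraint_mx (K L : comNzRingType) (f : {rmorphism K -> L})
    (Y : 'I_n -> {ffun profile S -> K}) :
  map_mx f (constraint_mx Y) =
  constraint_mx (fun i => [ffun j => f (Y i j)]).
Proof.
apply/matrixP => r c; rewrite !mxE !constraint_formE.
case: (enum_val r) => [x|j]; last by rewrite !ffunE rmorph_nat.
rewrite rmorph_sum; apply: eq_bigr => j _.
by rewrite !ffunE rmorphM rmorphB rmorph_nat.
Qed.

End ConstraintMatrix.

Section Lifting.
Variables (R : realType) (G : game R).
Hypothesis G_generic : generic G.
Let S := strategy G.
Let X := payoff G.

(** In a generic game a minor that vanishes at the payoffs vanishes identically, hence also after
    substituting polynomials for the payoffs. *)
Lemma generic_det_poly (Y : 'I_(nplayers G) -> {ffun profile S -> {poly R}})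
    (rows : 'I_#|profile S| -> 'I_#|constraint S|) :
  \det (rowsub rows (constraint_mx X)) = 0 ->
  \det (rowsub rows (constraint_mx Y)) = 0.
Proof.
move=> dX; have [/injectiveP rows_inj|] := boolP (injectiveb rows); last first.
  move=> /injectivePn[r1 [r2 r12 rE]].
  by apply: (determinant_alternate r12) => c; rewrite !mxE rE.
pose v (x : 'I_(npayoffs S)) : {poly R} := let: (i, j) := enum_val x in Y i j.
have -> : constraint_mx Y = map_mx (mmap (polyC : {rmorphism R -> {poly R}}) v)
    (constraint_mx (@indeterminate_payoffs _ S R)).
  rewrite map_constraint_mx; congr constraint_mx.
  apply/funext => i; apply/ffunP => j.
  by rewrite !ffunE /= mmapX mmap1U /v enum_rankK.
rewrite -map_mxsub det_map_mx.
have [->|dS] := eqVneq (\det (rowsub rows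
   (constraint_mx (@indeterminate_payoffs _ S R)))) 0; first by rewrite rmorph0.
by have := G_generic rows_inj dS; rewrite -/S -/X dX eqxx.
Qed.

(* Take D rows of [constraint_mx] with nonzero determinant that contain as many
   of the rows vanishing at [p] as possible.  Replacing one of the other D rows
   by a row vanishing at [p] gives a minor that vanishes at [X], hence also at
   [X + t Z], so that the corresponding columns of the adjugate matrix at
   [X + t Z] are killed by every row vanishing at [p]; at t = 0 these columns
   span [p]. *)
Lemma tight_lift (p : profile S -> R) (Y : 'I_(nplayers G) -> {ffun profile S -> {poly R}}) :
  (forall i j, (Y i j).[0] = X i j) ->
  exists q : profile S -> {poly R}, [/\ forall j, (q j).[0] = p j,
    forall j, p j = 0 -> q j = 0
  & forall i (k l : S i), regret X p k l = 0 -> regret Y q k l = 0].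
Proof.
move=> YX; set D := #|profile S|; set m := #|constraint S|.
pose A := constraint_mx X; pose At := constraint_mx Y.
pose pc : 'cV[R]_D := \col_c p (enum_val c).
pose vanish (r : 'I_m) := (A *m pc) r 0 == 0.
have AtA : map_mx (horner_eval 0) At = A.
  rewrite map_constraint_mx; congr constraint_mx.
  by apply/funext => i; apply/ffunP => j; rewrite ffunE /= /horner_eval YX.
pose good (f : {ffun 'I_D -> 'I_m}) := \det (rowsub f A) != 0.
pose f0 : {ffun 'I_D -> 'I_m} := [ffun c => enum_rank (inr (enum_val c) : constraint S)].
have good0 : good f0.
  rewrite /good (_ : rowsub f0 A = 1%:M) ?det1 ?oner_eq0 //.
  apply/matrixP => r c; rewrite !mxE ffunE enum_rankK /= ffunE.
  by rewrite (inj_eq enum_val_inj).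
have [f fgood fmax] := arg_maxnP (fun f : {ffun _} => #|[pred c | vanish (f c)]|) good0.
pose N := rowsub f A; pose Nt := rowsub f At.
have kill (r : 'I_m) (c : 'I_D) : vanish r -> ~~ vanish (f c) ->
    (At *m \adj Nt) r c = 0.
  move=> vr vc; pose g : {ffun 'I_D -> 'I_m} := [ffun c' => if c' == c then r else f c'].
  have dg : \det (rowsub g A) = 0.
    apply/eqP/negPn/negP => gg; have /= := fmax g gg; rewrite leqNgt => /negP[].
    apply: proper_card; apply/properP; split; last first.
      by exists c; rewrite inE ?ffunE ?eqxx.
    apply/fintype.subsetP => c'; rewrite !inE ffunE.
    by have [_ _|] := eqVneq c' c.
  (* Laplace expansion along row [c]: the entry [(r, c)] of the product with the adjugate is the
     determinant of [Nt] with row [c] replaced by row [r] of [At]. *)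
  rewrite -(generic_det_poly Y dg) (expand_det_row _ c) mxE.
  apply: eq_bigr => c' _; rewrite !mxE ffunE eqxx; congr (_ * (_ * \det _)).
  apply/matrixP => r1 c1; rewrite !mxE ffunE.
  by rewrite eq_sym (negPf (neq_lift _ _)).
(* Chosen so that [\adj N *m v] is [pc]. It is zero at the chosen rows that vanish at [p], so only
   columns of the adjugate covered by [kill] contribute to [qt]. *)
pose v : 'cV[R]_D := (\det N)^-1 *: (N *m pc).
pose qt : 'cV[{poly R}]_D := \adj Nt *m map_mx polyC v.
have qt0 : map_mx (horner_eval 0) qt = pc.
  rewrite map_mxM map_mx_adj /Nt map_mxsub AtA -map_mx_comp -/N.
  have -> : map_mx (horner_eval 0 \o polyC) v = v.
    by apply/matrixP => r c; rewrite mxE /= /horner_eval hornerC.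
  by rewrite /v -scalemxAr mulmxA mul_adj_mx mul_scalar_mx scalerA mulVf ?scale1r.
have Atq r : vanish r -> (At *m qt) r 0 = 0.
  move=> vr; rewrite mulmxA mxE big1 // => c _.
  have [vc|vc] := boolP (vanish (f c)); last by rewrite kill ?mul0r.
  have Nc : (N *m pc) c 0 = (A *m pc) (f c) 0.
    by rewrite !mxE; apply: eq_bigr => c' _; rewrite [N _ _]mxE.
  have v0 : v c 0 = 0.
    by rewrite /v mxE Nc; move/eqP: vc => ->; rewrite mulr0.
  by rewrite [map_mx _ _ _ _]mxE v0 polyC0 mulr0.
pose q (j : profile S) : {poly R} := qt (enum_rank j) 0.
have qP (r : constraint S) : constraint_form X r [ffun j => p j] = 0 ->
    constraint_form Y r [ffun j => q j] = 0.
  move=> rp; rewrite -(enum_rankK r) -constraint_mx_mul -[RHS](Atq (enum_rank r)).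
    by rewrite mxE; apply: eq_bigr => c _; rewrite /q enum_valK.
  rewrite /vanish mxE; apply/eqP; rewrite -[RHS]rp -[in RHS](enum_rankK r).
  by rewrite -constraint_mx_mul; apply: eq_bigr => c _; rewrite [pc _ _]mxE.
exists q; split.
- move=> j; have /matrixP/(_ (enum_rank j) 0) := qt0.
  by rewrite [LHS]mxE [RHS]mxE enum_rankK.
- by move=> j pj; have := qP (inr j); rewrite !constraint_formE !ffunE => ->.
- move=> i k l; have [->|kl] := eqVneq k l; first by rewrite !regret_diag.
  have rp : @regret _ _ _ X [ffun j => p j] i k l = regret X p k l.
    by apply: eq_bigr => j _; rewrite ffunE.
  have rq : @regret _ _ _ Y [ffun j => q j] i k l = regret Y q k l.
    by apply: eq_bigr => j _; rewrite ffunE.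
  rewrite -rp -rq => pkl.
  have := qP (inl (Sub (Tagged (fun i => (S i * S i)%type) (k, l)) kl)).
  by rewrite !constraint_formE; apply.
Qed.

Lemma tight_flow_invariant (a : forall i, S i -> S i -> R) p :
  tight X a p -> flow_invariant a p.
Proof.
move=> [ap gp]; apply: gain_flow_invariant => Z.
pose Y i : {ffun profile S -> {poly R}} := [ffun j => (X i j)%:P + (Z i j) *: 'X].
have [i j|q [q0 qp qr]] := @tight_lift p Y; first by rewrite ffunE !hornerE ?mulr0 ?addr0.
have regret_deriv i (k l : S i) : (regret Y q k l)^`().[0] =
    regret Z p k l + regret X (fun j => (q j)^`().[0]) k l.
  rewrite /regret raddf_sum /= horner_sum -big_split /=; apply: eq_bigr => j _.
  rewrite !ffunE derivM !derivE !hornerE q0; ring.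
(* The tensor moves along with the payoffs, but its derivative does not contribute: [q j] is
   identically zero where [p j] is zero, and [gain X a j] is zero elsewhere. *)
have gain0 j : gain X a j * (q j)^`().[0] = 0.
  have [/qp ->|pj] := eqVneq (p j) 0; first by rewrite linear0 horner0 mulr0.
  by have /eqP := gp j; rewrite mulf_eq0 (negPf pj) orbF => /eqP ->; rewrite mul0r.
have : \sum_j gain Z a j * p j + \sum_j gain X a j * (q j)^`().[0] = 0.
  rewrite -!sum_regret -big_split big1 // => i _.
  rewrite -big_split big1 // => k _; rewrite -big_split big1 // => l _.
  rewrite /= -mulrDr -regret_deriv.
  have /eqP := ap i k l; rewrite mulf_eq0 => /orP[/eqP->|/eqP/qr ->].
    by rewrite mul0r.
  by rewrite linear0 horner0 mulr0.
by rewrite [X in _ + X]big1 ?addr0.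
Qed.

End Lifting.

(** * Marginals, and the joint chain on profiles *)

Section Marginal.
Variables (R : realFieldType) (n : nat) (S : 'I_n -> finType).
Implicit Types (q : profile S -> R) (a : forall i, S i -> S i -> R).

Definition marginal q i (k : S i) : R := \sum_(j : profile S | j i == k) q j.

Lemma marginal_ge0 q i (k : S i) : (forall j, 0 <= q j) -> 0 <= marginal q k.
Proof. by move=> q0; apply: sumr_ge0. Qed.

Lemma marginal_gt0 q (j : profile S) i : (forall j, 0 <= q j) -> 0 < q j ->
  0 < marginal q (j i).
Proof.
by move=> q0 qj; rewrite /marginal (bigD1 j) //= ltr_pwDl // sumr_ge0.
Qed.

Lemma sum_upd (F : profile S -> R) i (k l : S i) :
  \sum_(j : profile S | j i == k) F (upd j l) = \sum_(j : profile S | j i == l) F j.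
Proof.
rewrite -(sum_glue k (fun j => F (upd j l))) -sum_glue.
by apply: eq_bigr => o _; rewrite upd_glue.
Qed.

Lemma marginal_stationary a q i : flow_invariant a q ->
  stationary (a i) (@marginal q i).
Proof.
move=> aq k; rewrite /marginal mulr_sumr.
transitivity (\sum_(j : profile S | j i == k) \sum_l a i l k * q (upd j l)).
  by apply: eq_bigr => j /eqP <-; exact: aq.
rewrite exchange_big; apply: eq_bigr => l _.
by rewrite -mulr_sumr sum_upd.
Qed.

(* The continuous-time Markov chain on profiles in which each player [i] jumps
   with rates [a i], independently of the others. *)
Definition profile_rate a (j j' : profile S) : R :=
  \sum_i \sum_(l : S i) (upd j l == j')%:R * a i (j i) l.

Lemma profile_rate_stationary a q : flow_invariant a q ->
  stationary (profile_rate a) q.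
Proof.
move=> aq j.
have -> : \sum_j' profile_rate a j j' = \sum_i \sum_(l : S i) a i (j i) l.
  rewrite exchange_big; apply: eq_bigr => i _; rewrite exchange_big.
  apply: eq_bigr => l _; rewrite -mulr_suml (bigD1 (upd j l)) //= eqxx.
  by rewrite big1 ?addr0 ?mul1r // => j' /negPf; rewrite eq_sym => ->.
transitivity (\sum_i \sum_(k : S i) a i k (j i) * q (upd j k)).
  by rewrite mulr_suml; apply: eq_bigr => i _; exact: aq.
transitivity (\sum_i \sum_(j' : profile S) \sum_(l : S i)
    (upd j' l == j)%:R * a i (j' i) l * q j'); last first.
  rewrite exchange_big; apply: eq_bigr => j' _; rewrite mulr_suml.
  by apply: eq_bigr => i _; rewrite mulr_suml.
apply: eq_bigr => i _; rewrite sum_upd_swap (bigD1 j) //= [X in _ + X]big1 ?addr0.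
  by apply: eq_bigr => k _; rewrite upd_upd upd_id upd_same eqxx mul1r.
move=> j' /negPf jj'; rewrite big1 // => l _.
by rewrite upd_upd upd_id jj' !mul0r.
Qed.

Lemma profile_rate_ge0 a j j' : (forall i k l, 0 <= a i k l) ->
  0 <= profile_rate a j j'.
Proof. by move=> a0; do 2 (apply: sumr_ge0 => ? _); rewrite mulr_ge0. Qed.

Lemma profile_rate_connect1 a (j : profile S) i (l : S i) :
  (forall i k l, 0 <= a i k l) ->
  connect (jump (a i)) (j i) l -> connect (jump (profile_rate a)) j (upd j l).
Proof.
move=> a0 /connectP[s]; elim: s j => [|m s IHs] j /=.
  by move=> _ ->; rewrite upd_id connect0.
case/andP=> jm ms lE; apply: (@connect_trans _ _ (upd j m)).
  apply: connect1; rewrite /jump /profile_rate (bigD1 i) //= (bigD1 m) //=.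
  rewrite eqxx mul1r -addrA ltr_pwDl // addr_ge0 ?sumr_ge0 // => *.
    by rewrite mulr_ge0.
  by rewrite sumr_ge0 // => *; rewrite mulr_ge0.
by have := IHs (upd j m); rewrite upd_same upd_upd; apply.
Qed.

Lemma profile_rate_connect a (T : forall i, {set S i}) (j j' : profile S) :
  (forall i k l, 0 <= a i k l) ->
  (forall i, {in T i &, forall k l, connect (jump (a i)) k l}) ->
  box T j -> box T j' -> connect (jump (profile_rate a)) j j'.
Proof.
move=> a0 conn /forallP jT /forallP jT'.
(* The path moves one player at a time; in [mix s] the players of [s] have already moved. *)
pose mix (s : seq 'I_n) : profile S := [ffun i => if i \in s then j' i else j i].
have mixT s i : mix s i \in T i by rewrite ffunE; case: ifP.
suff -> : j' = mix (enum 'I_n).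
  elim: (enum 'I_n) => [|i s IHs].
    by rewrite (_ : mix [::] = j) ?connect0 //; apply/ffunP => i; rewrite ffunE.
  apply: connect_trans IHs _.
  have -> : mix (i :: s) = upd (mix s) (j' i).
    apply/ffunP => i'; have [->|ii'] := eqVneq i' i.
      by rewrite upd_same ffunE inE eqxx.
    by rewrite upd_other // !ffunE inE (negPf ii').
  by apply: profile_rate_connect1 => //; apply: conn.
by apply/ffunP => i; rewrite ffunE mem_enum.
Qed.

End Marginal.

(** * Dimension and affine hulls of equilibrium polytopes *)

Section TotalMass.
Variables (R : realFieldType) (I : finType).

Definition total (x : {ffun I -> R^o}) : R^o := \sum_i x i.

Fact total_is_linear : linear total.
Proof.
move=> c x y; rewrite /total scaler_sumr -big_split.
by apply: eq_bigr => i _; rewrite !ffunE.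
Qed.

HB.instance Definition _ :=
  GRing.isLinear.Build R {ffun I -> R^o} R^o _ total total_is_linear.

Lemma dim_lker_total : (0 < #|I|)%N -> \dim (lker (linfun total)) = #|I|.-1.
Proof.
move=> /card_gt0P[i0 _]; have := limg_ker_dim (linfun total) fullv.
rewrite capfv dimvf (_ : dim _ = #|I|); last by rewrite /dim /= muln1.
have -> : (linfun total @: fullv = fullv)%VS.
  apply/eqP; rewrite eqEsubv subvf /=; apply/subvP => c _.
  suff -> : c = linfun total [ffun i => (i == i0)%:R * c] by rewrite memv_img ?memvf.
  rewrite lfunE /= /total (bigD1 i0) //= ffunE eqxx mul1r big1 ?addr0 //.
  by move=> i /negPf ii0; rewrite ffunE ii0 mul0r.
by rewrite dimvf (_ : dim _ = 1%N) // addn1 => <-.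
Qed.

End TotalMass.

Section AffineIsomorphism.
Variables (R : realType) (E F : lmodType R).

Lemma linear_affinely_isomorphic (P : set E) (Q : set F) (f : E -> F) :
  (forall m (c : 'I_m -> R) (x : 'I_m -> E),
     f (\sum_i c i *: x i) = \sum_i c i *: f (x i)) ->
  (f @` P = Q)%classic ->
  (forall x y, affine_hull P x -> affine_hull P y -> f x = f y -> x = y) ->
  affinely_isomorphic P Q.
Proof.
move=> fL fPQ finj; exists f.
split; [split|by move=> m c x _ _; exact: fL|exact: fPQ].
- move=> _ [m [c [x [Px c1 ->]]]]; exists m, c, (f \o x); split=> //.
  by move=> i; rewrite -fPQ; exists (x i).
- by move=> x y; rewrite !inE => xP yP; exact: finj.
- move=> _ [m [c [y [Qy c1 ->]]]].
  have /fin_all_exists2[x Px xy] (i : 'I_m) : exists2 x, P x & f x = y i.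
    by have := Qy i; rewrite -fPQ => -[x Px xy]; exists x.
  exists (\sum_i c i *: x i); first by exists m, c, x.
  by rewrite fL; apply: eq_bigr => i _; rewrite xy.
Qed.

End AffineIsomorphism.

Lemma small_step (R : realFieldType) (I : finType) (u v : I -> R) :
  (forall i, 0 < u i) -> exists2 e, 0 < e & forall i, 0 <= u i + e * v i.
Proof.
move=> u0; pose s := 1 + \sum_i `|v i| / u i.
have t0 i : 0 <= `|v i| / u i by rewrite divr_ge0 // ltW.
have s0 : 0 < s by rewrite ltr_wpDr // sumr_ge0.
exists s^-1; rewrite ?invr_gt0 // => i.
have vi : `|v i| <= s * u i.
  rewrite -ler_pdivrMr // /s (bigD1 i) //= addrCA lerDl addr_ge0 ?sumr_ge0 //.
rewrite -(pmulr_rge0 _ s0) mulrDr mulVKf ?gt_eqF //.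
by rewrite -lerBlDr sub0r (le_trans _ vi) // -normrN ler_norm.
Qed.

Lemma equilibriumP (R : realType) (G : game R) (q : tensor G) :
  correlated_equilibria G q <->
  [/\ forall j, 0 <= (q j : R), \sum_j (q j : R) = 1 &
      forall i (k l : strategy G i), 0 <= regret (K := R) (payoff G) q k l].
Proof.
split=> [[[q0 q1] qX]|[q0 q1 qX]]; first by split=> // i k l; rewrite -incentiveE.
by split=> [|i k l]; [split|rewrite incentiveE].
Qed.

(* Around an equilibrium with all constraints slack one can move in all
   directions of total mass zero. *)
Lemma slack_full_dimensional (R : realType) (G : game R) (x0 : tensor G) :
  correlated_equilibria G x0 ->
  (forall j, 0 < (x0 j : R)) ->
  (forall i (k l : strategy G i), k != l ->
    0 < regret (payoff G) (x0 : profile (strategy G) -> R) k l) ->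
  full_dimensional G.
Proof.
move=> /equilibriumP[_ x1 xX] x0_gt0 xX_gt0.
have tot1 (x : tensor G) : correlated_equilibria G x -> total x = 1 by case=> -[].
exists x0, (lker (linfun (@total R (profile (strategy G))))); split.
  apply: dim_lker_total; apply: contraT; rewrite -eqn0Ngt => /eqP/card0_eq N.
  move: x1; rewrite big_pred0 => [/eqP|j]; first by rewrite eq_sym oner_eq0.
  by have := N j; rewrite inE.
apply/seteqP; split=> [_ [m [c [y [Py c1 ->]]]]|x /=].
  rewrite /= memv_ker lfunE /= linearB linear_sum /=.
  rewrite [total x0]x1 -c1 subr_eq0; apply/eqP/eq_bigr => i _.
  by rewrite linearZ /= tot1 // [RHS](esym (mulr1 _)).
rewrite memv_ker lfunE /= linearB /= subr_eq0 => /eqP xtot.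
pose dev := {i : 'I_(nplayers G) & (strategy G i * strategy G i)%type}.
(* Diagonal deviations have regret zero; the dummy value 1 keeps [u] positive there. *)
pose u (r : profile (strategy G) + dev) : R := match r with
  | inl j => x0 j
  | inr d => if (tagged d).1 == (tagged d).2 then 1
             else regret (payoff G) (x0 : profile (strategy G) -> R) (tagged d).1 (tagged d).2 end.
pose v (r : profile (strategy G) + dev) : R := match r with
  | inl j => x j - x0 j
  | inr d => regret (payoff G) (fun j => x j - x0 j : R) (tagged d).1 (tagged d).2 end.
have [|e e0 eP] := @small_step _ _ u v.
  by case=> [j|d] /=; rewrite ?x0_gt0 //; case: eqVneq => // /xX_gt0.
have e_neq0 : e != 0 by rewrite gt_eqF.
pose y : tensor G := x0 + e *: (x - x0).
have yE j : y j = x0 j + e * (x j - x0 j) :> R by rewrite !ffunE.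
have Py : correlated_equilibria G y.
  apply/equilibriumP; split.
  - by move=> j; rewrite yE; exact: (eP (inl j)).
  - rewrite -[LHS]/(total y) linearD linearZ linearB /= xtot subrr scaler0 addr0.
    exact: x1.
  - move=> i k l; have [->|kl] := eqVneq k l; first by rewrite regret_diag.
    have := eP (inr (Tagged _ (k, l))); rewrite /= (negPf kl) -regretZ -regretD.
    by rewrite (eq_regret _ _ _ (yE : (y : profile (strategy G) -> R) =1 _)).
(* Solving [y = x0 + e *: (x - x0)] for [x] gives an affine combination of two equilibria, in
   general not a convex one. *)
exists 2%N, (fun i : 'I_2 => if i == ord0 then 1 - e^-1 else e^-1),
  (fun i : 'I_2 => if i == ord0 then x0 else y); split.
- by move=> i; case: ifP => // _; apply/equilibriumP; split=> // j; exact: ltW.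
- by rewrite !big_ord_recl big_ord0 /= addr0 subrK.
- rewrite !big_ord_recl big_ord0 /= addr0 /y scalerDr scalerA mulVf // scale1r.
  by rewrite scalerBl scale1r addrA subrK addrC subrK.
Qed.

(** * Restriction to a subgame and extension by zero *)

Section Restriction.
Variables (R : realType) (G : game R).
Let S := strategy G.
Let X := payoff G.
Variables (T : forall i, {set S i}) (T_neq0 : forall i, T i != finset.set0).
Let G' := subgame T_neq0.
Let S' := @sub_strategy R G T.
Let embed : profile S' -> profile S := @sub_profile R G T.

Lemma sub_profile_inj : injective embed.
Proof.
move=> j1 j2 /ffunP j12; apply/ffunP => i; apply: val_inj.
by have := j12 i; rewrite !ffunE.
Qed.

Lemma sub_profile_box (j : profile S) : box T j = (j \in embed @: finset.setT).
Proof.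
apply/forallP/imsetP => [jT|[j' _ -> i]]; last by rewrite ffunE (valP (j' i)).
exists [ffun i => Sub (j i) (jT i)] => //; apply/ffunP => i.
by rewrite !ffunE SubK.
Qed.

Lemma sum_sub_profile (q : profile S -> R) : (forall j, ~~ box T j -> q j = 0) ->
  \sum_j q j = \sum_j' q (embed j').
Proof.
move=> qT; rewrite (bigID (box T)) /= [X in _ + X]big1 ?addr0 //.
rewrite (eq_bigl _ _ sub_profile_box) big_imset /=; last first.
  by move=> ? ? _ _; exact: sub_profile_inj.
by apply: eq_bigl => j'; rewrite inE.
Qed.

Lemma sub_profile_upd (j' : profile S') i (l : S' i) :
  embed (upd j' l) = upd (embed j') (val l).
Proof.
apply/ffunP => i'; rewrite [LHS]ffunE; have [->|ii'] := eqVneq i' i.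
  by rewrite !upd_same.
by rewrite !upd_other // [RHS]ffunE.
Qed.

Lemma regret_sub_profile (q : profile S -> R) i (k l : S' i) : (forall j, ~~ box T j -> q j = 0) ->
  regret X q (val k) (val l) = regret (payoff G') (fun j' => q (embed j')) k l.
Proof.
move=> qT; rewrite !regretE sum_sub_profile => [|j jT]; last by rewrite qT ?mulr0.
apply: eq_bigr => j' _; rewrite -sub_profile_upd [in RHS]ffunE [in RHS]ffunE.
by rewrite [embed j' i]ffunE (inj_eq val_inj).
Qed.

(** Extension by zero, written as a sum over a fibre of the injective [embed], so that no membership
    proof has to be carried along. *)
Definition extend (q' : profile S' -> R) (j : profile S) : R :=
  \sum_(j' | embed j' == j) q' j'.

Lemma extend_sub_profile q' j' : extend q' (embed j') = q' j'.
Proof.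
by rewrite /extend (big_pred1 j') // => j; rewrite /= (inj_eq sub_profile_inj).
Qed.

Lemma extend_box q' j : ~~ box T j -> extend q' j = 0.
Proof.
move=> jT; rewrite /extend big_pred0 // => j'; apply/negbTE.
by apply: contraNneq jT => <-; rewrite sub_profile_box imset_f ?inE.
Qed.

Lemma extend_ge0 q' j : (forall j', 0 <= q' j') -> 0 <= extend q' j.
Proof. by move=> q'0; apply: sumr_ge0. Qed.

Lemma sum_extend q' : \sum_j extend q' j = \sum_j' q' j'.
Proof.
rewrite sum_sub_profile => [|j]; last exact: extend_box.
by apply: eq_bigr => j' _; rewrite extend_sub_profile.
Qed.

Lemma regret_extend q' i (k l : S' i) :
  regret X (extend q') (val k) (val l) = regret (payoff G') q' k l.
Proof.
rewrite regret_sub_profile => [|j]; last exact: extend_box.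
by apply: eq_bigr => j' _; rewrite extend_sub_profile.
Qed.

Definition restrict (q : tensor G) : tensor G' := [ffun j' => q (embed j')].

Lemma restrict_equilibrium (q : tensor G) : correlated_equilibria G q ->
  (forall j, ~~ box T j -> q j = 0) -> correlated_equilibria G' (restrict q).
Proof.
move=> /equilibriumP[q0 q1 qX] qT; apply/equilibriumP; split.
- by move=> j'; rewrite ffunE.
- by under eq_bigr do rewrite ffunE; rewrite -(sum_sub_profile (q := q)).
- move=> i k l; have := qX i (val k) (val l).
  rewrite (regret_sub_profile (q := q)) // => qkl.
  rewrite (_ : regret _ _ _ _ = regret (payoff G') (fun j' => q (embed j') : R) k l) //.
  by apply: eq_bigr => j' _; congr (_ * _); rewrite ffunE.
Qed.

Lemma restrict_sum m (c : 'I_m -> R) (x : 'I_m -> tensor G) :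
  restrict (\sum_i c i *: x i) = \sum_i c i *: restrict (x i).
Proof.
apply/ffunP => j'; rewrite ffunE !sum_ffunE; apply: eq_bigr => i _.
by rewrite !ffunE.
Qed.

Lemma restrict_isomorphism :
  (forall q : tensor G, correlated_equilibria G q -> forall j, ~~ box T j -> q j = 0) ->
  (forall q' : tensor G', correlated_equilibria G' q' ->
     correlated_equilibria G [ffun j => extend q' j]) ->
  affinely_isomorphic (correlated_equilibria G) (correlated_equilibria G').
Proof.
move=> PT Pext; apply: (@linear_affinely_isomorphic _ _ _ _ _ restrict).
- exact: restrict_sum.
- apply/seteqP; split=> [_ [q Pq <-]|q' Pq'].
    by apply: restrict_equilibrium => //; exact: PT.
  exists [ffun j => extend q' j]; first exact: Pext.
  by apply/ffunP => j'; rewrite !ffunE extend_sub_profile.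
- have hullT x : affine_hull (correlated_equilibria G) x ->
      forall j, ~~ box T j -> x j = 0.
    move=> [m [c [y [Py _ ->]]]] j jT; rewrite sum_ffunE big1 // => i _.
    by rewrite ffunE PT ?scaler0.
  move=> x y /hullT xT /hullT yT /ffunP xy; apply/ffunP => j.
  have [|jT] := boolP (box T j); last by rewrite xT ?yT.
  by rewrite sub_profile_box => /imsetP[j' _ ->]; have := xy j'; rewrite !ffunE.
Qed.

End Restriction.

(** * Consequences of a strictly complementary pair in a generic game *)

Section StrictlyComplementary.
Variables (R : realType) (G : game R).
Hypothesis G_generic : generic G.
Let S := strategy G.
Let X := payoff G.
Variables (p : profile S -> R) (a : forall i, S i -> S i -> R).
Arguments a : clear implicits.
Implicit Types (q : profile S -> R) (T : forall i, {set S i}).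
Hypotheses (p_ge0 : forall j, 0 <= p j) (p_gt0 : 0 < \sum_j p j).
Hypothesis regret_p_ge0 : forall i (k l : S i), 0 <= regret X p k l.
Hypotheses (a_ge0 : forall i k l, 0 <= a i k l) (gain_le0 : forall j, gain X a j <= 0).
Hypothesis a_gt0 : forall i (k l : S i), 0 < a i k l \/ 0 < regret X p k l.
Hypothesis gain_lt0 : forall j, 0 < p j \/ gain X a j < 0.

Lemma p_tight : tight X a p.
Proof.
apply: complementary => [i k l|j]; first by rewrite mulr_ge0.
by rewrite mulr_le0_ge0.
Qed.

Lemma p_flow : flow_invariant a p.
Proof. exact: tight_flow_invariant p_tight. Qed.

Definition used i : {set S i} := [set k | 0 < marginal p k].

Lemma used_profile i (k : S i) : k \in used i -> exists2 j : profile S, j i = k & 0 < p j.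
Proof.
rewrite inE => k0; apply: contrapT => Nk; move: k0; rewrite /marginal big1 ?ltxx //.
move=> j /eqP jk; apply/eqP; rewrite eq_le p_ge0 andbT leNgt.
by apply/negP => pj; apply: Nk; exists j.
Qed.

Lemma mem_used (j : profile S) i : 0 < p j -> j i \in used i.
Proof. by move=> pj; rewrite inE marginal_gt0. Qed.

Lemma gain_eq0 j : (gain X a j == 0) = (0 < p j).
Proof.
have [_ /(_ j)/eqP] := p_tight; rewrite mulf_eq0.
case: (gain_lt0 j) => [pj|gj]; first by rewrite pj (gt_eqF pj) orbF.
by rewrite (lt_eqF gj) /= => /eqP ->; rewrite ltxx.
Qed.

(** The product of the marginals is flow invariant, so its sum against [gain X a] is zero. All terms
    are nonpositive, hence the gain vanishes wherever the product is positive, and strict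
    complementarity makes [p] positive there. *)
Lemma box_used (j : profile S) : box used j = (0 < p j).
Proof.
apply/forallP/idP => [ju|pj i]; last exact: mem_used.
rewrite -gain_eq0; pose m (j : profile S) := \prod_i marginal p (j i).
have flow : flow_invariant a m.
  by apply: product_flow_invariant => i; apply: marginal_stationary p_flow.
have m0 j' : 0 <= m j' by apply: prodr_ge0 => i _; exact: marginal_ge0.
have mj : 0 < m j by apply: prodr_gt0 => i _; have := ju i; rewrite inE.
have := flow_invariant_gain X flow => /eqP.
rewrite -oppr_eq0 -sumrN psumr_eq0 => [|j' _]; last by rewrite oppr_ge0 mulr_le0_ge0.
move=> /allP/(_ j); rewrite mem_index_enum => /(_ isT).
by rewrite oppr_eq0 mulf_eq0 (gt_eqF mj) orbF.
Qed.

Lemma used_closed i (k l : S i) : k \in used i -> jump (a i) k l -> l \in used i.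
Proof.
rewrite !inE => k0 kl; apply: stationary_gt0 kl k0 => //.
  by move=> k'; exact: marginal_ge0.
exact: marginal_stationary p_flow.
Qed.

Lemma used_connect i (k l : S i) :
  k \in used i -> connect (jump (a i)) k l -> l \in used i.
Proof.
rewrite !inE => k0 kl; apply: stationary_connect_gt0 kl k0 => //.
  by move=> k'; exact: marginal_ge0.
exact: marginal_stationary p_flow.
Qed.

Lemma used_connectC i (k l : S i) :
  k \in used i -> connect (jump (a i)) k l -> connect (jump (a i)) l k.
Proof.
rewrite inE => k0 kl; apply: stationary_connectC kl k0 => //.
  by move=> k'; exact: marginal_ge0.
exact: marginal_stationary p_flow.
Qed.

Lemma used_neq0 i : used i != finset.set0.
Proof.
have [j pj] : exists j, 0 < p j.
  apply/not_existsP => Np; move: p_gt0; apply/negP; rewrite -leNgt.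
  by apply: sumr_le0 => j _; rewrite leNgt; apply/negP/Np.
by apply/set0Pn; exists (j i); exact: mem_used.
Qed.

Lemma a_eq0 i (k l : S i) : ~~ jump (a i) k l -> a i k l = 0.
Proof. by move=> Nkl; apply/eqP; rewrite eq_le a_ge0 andbT leNgt. Qed.

Definition closed_block (T : forall i, {set S i}) := forall i,
  T i \subset used i /\ forall k l, k \in T i -> jump (a i) k l -> l \in T i.

(** On tensors supported in a block closed under jumps, positive weights occur only at deviations
    inside the block. The multipliers of the whole game therefore certify equilibria of each
    block. *)
Lemma block_tight T q : closed_block T -> (forall j, 0 <= q j) ->
  (forall j, ~~ box T j -> q j = 0) ->
  (forall i (k l : S i), k \in T i -> l \in T i -> 0 <= regret X q k l) ->
  tight X a q.
Proof.
move=> Tcl q0 qT qX; apply: complementary => [i k l|j]; last by rewrite mulr_le0_ge0.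
have [kT|kT] := boolP (k \in T i); last first.
  rewrite /regret big1 ?mulr0 // => j /eqP jk; rewrite qT ?mulr0 //.
  by apply/forallPn; exists i; rewrite jk.
have [kl|kl] := boolP (jump (a i) k l); last by rewrite a_eq0 ?mul0r.
by rewrite mulr_ge0 // qX //; have [_ ] := Tcl i; apply; first exact: kT.
Qed.

Lemma block_equilibrium T : closed_block T -> (forall i, T i != finset.set0) ->
  exists q, [/\ forall j, 0 <= q j, 0 < \sum_j q j,
     forall j, q j != 0 -> box T j & tight X a q].
Proof.
move=> Tcl /(equilibrium_exists X)[q [q0 qT qs qX]]; exists q; split=> //.
  by move=> j; apply: contra_neqT; exact: qT.
exact: (@block_tight T).
Qed.

Lemma block_marginal T q i1 (k : S i1) : closed_block T -> (forall j, 0 <= q j) ->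
  0 < \sum_j q j -> (forall j, q j != 0 -> box T j) -> tight X a q ->
  {in T i1 &, forall k l, connect (jump (a i1)) k l} ->
  (k \in T i1 -> 0 < marginal q k) /\ (k \notin T i1 -> marginal q k = 0).
Proof.
move=> Tcl q0 qs qT /(tight_flow_invariant G_generic) qflow conn; split=> kT.
  have [j qj] : exists j, 0 < q j.
    apply/not_existsP => Np; move: qs; apply/negP; rewrite -leNgt.
    by apply: sumr_le0 => j _; rewrite leNgt; apply/negP/Np.
  have /qT/forallP/(_ i1) jT : q j != 0 by rewrite gt_eqF.
  apply: (stationary_connect_gt0 _ _ _ (conn _ _ jT kT)) => //.
  - by move=> ?; exact: marginal_ge0.
  - exact: marginal_stationary.
  - exact: marginal_gt0.
rewrite /marginal big1 // => j /eqP jk; apply/eqP; apply: contraNT kT => /qT.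
by rewrite -jk => /forallP.
Qed.

(* First-order variation of the multipliers [a] when the payoffs vary in the
   direction [Z]. *)
Lemma multiplier_variation Z : exists a' : forall i, S i -> S i -> R,
  (forall i k l, a i k l = 0 -> a' i k l = 0) /\
  (forall j, 0 < p j -> gain X a' j = - gain Z a j).
Proof.
pose rows (r : {i : 'I_(nplayers G) & (S i * S i)%type} + profile S) (j : profile S) : R :=
  match r with
  | inl d => (a (tag d) (tagged d).1 (tagged d).2 != 0)%:R *
      ((j (tag d) == (tagged d).1)%:R *
      (X (tag d) j - X (tag d) (upd j (tagged d).2)))
  | inr j' => (~~ (0 < p j'))%:R * (j' == j)%:R
  end.
(* Solvability is tested against the tensors [x] that vanish off the support of [p] and satisfy
   every constraint of nonzero weight with equality. They are tight, hence flow invariant, hence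
   orthogonal to [gain Z a]. *)
have [x xr|c cb] := @fredholm _ _ _ rows (fun j => - gain Z a j).
  have tx : tight X a x.
    split=> [i k l|j].
      have [->|akl] := eqVneq (a i k l) 0; first by rewrite mul0r.
      have := xr (inl (Tagged _ (k, l))); rewrite /= akl.
      by under eq_bigr do rewrite mul1r; rewrite -regretE => ->; rewrite mulr0.
    have [pj|pj] := boolP (0 < p j).
      by move: pj; rewrite -gain_eq0 => /eqP ->; rewrite mul0r.
    have := xr (inr j); rewrite (bigD1 j) //= pj eqxx !mul1r big1 ?addr0.
      by move=> ->; rewrite mulr0.
    by move=> j' /negPf; rewrite eq_sym => ->; rewrite mulr0 mul0r.
  under eq_bigr do rewrite mulNr.
  by rewrite sumrN flow_invariant_gain ?oppr0 //; exact: tight_flow_invariant tx.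
exists (fun i k l => c (inl (Tagged _ (k, l))) * (a i k l != 0)%:R); split.
  by move=> i k l ->; rewrite eqxx mulr0.
move=> j pj; rewrite cb big_sumType /= [X in _ + X]big1 ?addr0; last first.
  move=> j' _; have [->|] := eqVneq j' j; first by rewrite pj mul0r mulr0.
  by rewrite !mulr0.
by rewrite gain_dev; apply: eq_bigr => -[i [k l]] _; rewrite /= -mulrA.
Qed.

Lemma gainD Y a1 a2 j : gain Y (fun i k l => a1 i k l + a2 i k l) j =
  gain Y a1 j + gain (S := S) (K := R) Y a2 j.
Proof.
by rewrite -big_split; apply: eq_bigr => i _; rewrite -big_split;
  apply: eq_bigr => l _; rewrite mulrDl.
Qed.

(* If [used i0] had a proper invariant part [U], one could scale the payoffs of
   the players other than [i1] at the profiles with [j i0 \in U] and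
   [j i1 = k1].  This changes the marginal of [i1] in the equilibria of the
   block [j i0 \in U] but not in those of the complementary block, whereas both
   marginals are determined by the same multipliers. *)
Lemma used_connected_other i0 i1 (x y : S i0) (k1 l1 : S i1) : i0 != i1 ->
  x \in used i0 -> y \in used i0 ->
  k1 \in used i1 -> k1 != l1 -> jump (a i1) k1 l1 ->
  connect (jump (a i0)) x y.
Proof.
move=> i01 xu yu k1u k1l1 kl; apply: contraT => Nxy.
pose U := [set z | connect (jump (a i0)) x z].
pose C := [set z | connect (jump (a i1)) k1 z].
pose T (B : {set S i0}) : forall i, {set S i} :=
  dfwith (dfwith used C) B.
have TE0 B : T B i0 = B by rewrite /T dfwith_in.
have TE1 B : T B i1 = C by rewrite /T dfwith_out // dfwith_in.
have TE B i : i != i0 -> i != i1 -> T B i = used i.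
  by move=> ii0 ii1; rewrite /T !dfwith_out // eq_sym.
have Usub z : z \in U -> z \in used i0 by rewrite inE; exact: used_connect.
have UC k l : k \in used i0 -> jump (a i0) k l -> (l \in U) = (k \in U).
  move=> ku jkl; rewrite !inE; apply/idP/idP => [xl|xk].
    apply: connect_trans xl _; apply: used_connectC => //; exact: connect1.
  apply: connect_trans xk _; exact: connect1.
have Tblock (B : {set S i0}) : B \subset used i0 ->
    (forall k l, k \in B -> jump (a i0) k l -> l \in B) -> B != finset.set0 ->
  exists q, [/\ forall j, 0 <= q j, forall j, q j != 0 -> 0 < p j /\ j i0 \in B,
     tight X a q, (forall k, k \in C -> 0 < @marginal _ _ _ q i1 k) &
     (forall k, k \notin C -> @marginal _ _ _ q i1 k = 0)].
  move=> Bu Bcl B0.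
  have Tcl : closed_block (T B).
    move=> i; have [->|ii0] := eqVneq i i0; first by rewrite TE0.
    have [->|ii1] := eqVneq i i1.
      rewrite TE1; split; first by apply/fintype.subsetP => z; rewrite inE; exact: used_connect.
      by move=> k l; rewrite !inE => /connect_trans h /connect1/h.
    by rewrite TE //; split=> // k l; exact: used_closed.
  have [i|q [q0 qs qT tq]] := block_equilibrium Tcl.
    have [->|ii0] := eqVneq i i0; first by rewrite TE0.
    have [->|ii1] := eqVneq i i1; last by rewrite TE // used_neq0.
    by rewrite TE1; apply/set0Pn; exists k1; rewrite inE connect0.
  have conn : {in T B i1 &, forall k l, connect (jump (a i1)) k l}.
    rewrite TE1 => k l; rewrite !inE => k1k k1l; apply: connect_trans k1l.
    exact: used_connectC.
  exists q; split=> //.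
  - move=> j /qT jT; rewrite -box_used; split.
      apply/forallP => i; have /fintype.subsetP := (Tcl i).1; apply.
      by have /forallP := jT; apply.
    by have /forallP/(_ i0) := jT; rewrite TE0.
  - by move=> k; have [] := block_marginal k Tcl q0 qs qT tq conn; rewrite TE1.
  - by move=> k; have [] := block_marginal k Tcl q0 qs qT tq conn; rewrite TE1.
have [|||q [q0 qU tq qC qNC]] := Tblock U.
- exact/fintype.subsetP.
- by move=> k l kU jkl; rewrite (UC k) // Usub.
- by apply/set0Pn; exists x; rewrite inE connect0.
have [|||q' [q'0 q'U tq' q'C q'NC]] := Tblock (used i0 :\: U).
- by apply/fintype.subsetP => z; rewrite inE => /andP[].
- move=> k l; rewrite !finset.in_setD => /andP[kU ku] jkl.
  by rewrite (UC k) // kU (used_closed ku).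
- by apply/set0Pn; exists y; rewrite !inE Nxy; rewrite inE in yu.
pose Z i : {ffun profile S -> R} :=
  [ffun j : profile S => ((i != i1) && (j i0 \in U) && (j i1 == k1))%:R * X i j].
have ZE i j : Z i j = ((i != i1) && (j i0 \in U) && (j i1 == k1))%:R * X i j.
  by rewrite ffunE.
have [a' [a'0 a'Z]] := multiplier_variation Z.
(* On [U], scaling the other players' payoffs at [j i1 = k1] is compensated by scaling the rates of
   [i1] out of [k1]. Subtracting this correction from [a'] leaves weights [a''] with zero gain on
   the support of [q]. *)
pose w : forall i, S i -> R := dfwith (fun i _ => 0) (fun k : S i1 => (k == k1)%:R).
have w1 k : w i1 k = (k == k1)%:R by rewrite /w dfwith_in.
have wo i k : i != i1 -> w i k = 0 by move=> ii1; rewrite /w dfwith_out // eq_sym.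
pose a'' i k l := a' i k l + - w i k * a i k l.
have Ustep j i l : 0 < p j -> a i (j i) l != 0 -> (upd j l i0 \in U) = (j i0 \in U).
  move=> pj al; have [ii0|ii0] := eqVneq i i0; last by rewrite upd_other // eq_sym.
  subst i; rewrite upd_same (UC (j i0)) ?mem_used //.
  by rewrite /jump lt_neqAle eq_sym al a_ge0.
(* Jumps from used strategies neither enter nor leave [U], so the support of [q'] does not see
   [Z]. *)
have tight' : tight X a' q'.
  split=> [i k l|j].
    have [/a'0 ->|akl] := eqVneq (a i k l) 0; first by rewrite mul0r.
    have /eqP := tq'.1 i k l; rewrite mulf_eq0 (negPf akl) => /eqP ->.
    by rewrite mulr0.
  have [->|/q'U[pj]] := eqVneq (q' j) 0; first by rewrite mulr0.
  rewrite finset.in_setD => /andP[jU _]; rewrite a'Z // /gain.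
  rewrite big1 ?oppr0 ?mul0r // => i _; rewrite big1 // => l _.
  have [->|al] := eqVneq (a i (j i) l) 0; first by rewrite mul0r.
  by rewrite !ZE Ustep // (negPf jU) !andbF /= !mul0r subrr mulr0.
have tight'' : tight X a'' q.
  split=> [i k l|j].
    have [a0|akl] := eqVneq (a i k l) 0; first by rewrite /a'' a0 a'0 // mulr0 addr0 mul0r.
    have /eqP := tq.1 i k l; rewrite mulf_eq0 (negPf akl) => /eqP ->.
    by rewrite mulr0.
  have [->|/qU[pj jU]] := eqVneq (q j) 0; first by rewrite mulr0.
  have -> : gain X a'' j = - (gain Z a j + gain X (fun i k l => w i k * a i k l) j).
    rewrite gainD a'Z // opprD; congr (_ + _).
    rewrite -sumrN; apply: eq_bigr => i _; rewrite -sumrN; apply: eq_bigr => l _.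
    by rewrite !mulNr.
  suff -> : gain Z a j + gain X (fun i k l => w i k * a i k l) j =
      (j i1 == k1)%:R * gain X a j.
    by move: pj; rewrite -gain_eq0 => /eqP ->; rewrite mulr0 oppr0 mul0r.
  rewrite mulr_sumr -big_split; apply: eq_bigr => i _.
  rewrite mulr_sumr -big_split; apply: eq_bigr => l _ /=.
  have [->|al] := eqVneq (a i (j i) l) 0; first by rewrite !(mul0r, mulr0) addr0.
  rewrite !ZE Ustep // jU andbT.
  have [ii1|ii1] := eqVneq i i1; first by subst i; rewrite w1 /= !mul0r subrr; ring.
  by rewrite wo // upd_other 1?eq_sym //=; ring.
have st := @marginal_stationary _ _ _ _ _ i1 (tight_flow_invariant G_generic tq).
have st' := @marginal_stationary _ _ _ _ _ i1 (tight_flow_invariant G_generic tq').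
have sta := @marginal_stationary _ _ _ _ _ i1 (tight_flow_invariant G_generic tight'').
have sta' := @marginal_stationary _ _ _ _ _ i1 (tight_flow_invariant G_generic tight').
have [||c mc] := @stationary_unique _ _ (a i1) _ _ C _ st st' q'C q'NC qNC.
- by move=> *; exact: a_ge0.
- move=> k l; rewrite !inE => k1k k1l; apply: connect_trans k1l.
  exact: used_connectC.
have k1C : k1 \in C by rewrite inE connect0.
(* By proportionality the marginal of [q] is stationary for both [a' i1] and [a'' i1]. At [l1] the
   two balances differ by the inflow from [k1], which is positive. *)
have /eqP := sta l1.
have -> : \sum_l a'' i1 l1 l = \sum_l a' i1 l1 l.
  by apply: eq_bigr => l _; rewrite /a'' w1 eq_sym (negPf k1l1) oppr0 mul0r addr0.
have -> : \sum_l a'' i1 l l1 * marginal q l =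
   \sum_l a' i1 l l1 * marginal q l - a i1 k1 l1 * marginal q k1.
  under eq_bigr do rewrite mulrDl.
  rewrite big_split /=; congr (_ + _).
  rewrite (bigD1 k1) //= w1 eqxx mulN1r mulNr big1 ?addr0 // => k /negPf kk1.
  by rewrite w1 kk1 oppr0 !mul0r.
have -> : (\sum_l a' i1 l1 l) * marginal q l1 = \sum_l a' i1 l l1 * marginal q l.
  rewrite mc mulrCA sta' mulr_sumr; apply: eq_bigr => l _.
  by rewrite mc mulrCA.
by rewrite -subr_eq0 opprB addrCA subrr addr0 gt_eqF // mulr_gt0 ?qC.
Qed.

Lemma connect_trivial i (x y : S i) : x \in used i ->
  (forall k l, k \in used i -> jump (a i) k l -> k = l) ->
  connect (jump (a i)) x y -> x = y.
Proof.
move=> xu triv /connectP[s]; elim: s x xu => [|m s IHs] x xu /=; first by move=> _ ->.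
by case/andP=> xm ms yE; rewrite (triv x m) //; apply: IHs => //; exact: used_closed xm.
Qed.

(** If a second player also jumps, each of the two proves connectedness for the other. If only [i1]
    jumps, all others have a single used strategy; the point mass at the profile with [k1] is then
    tight, yet it loses mass towards [l1]. *)
Lemma used_connected i1 (k1 l1 : S i1) :
  k1 \in used i1 -> k1 != l1 -> jump (a i1) k1 l1 ->
  forall i, {in used i &, forall k l, connect (jump (a i)) k l}.
Proof.
move=> k1u k1l1 kl; pose trivial i := forall k l, k \in used i -> jump (a i) k l -> k = l.
have [triv i x y xu yu|] := pselect (forall i, i != i1 -> trivial i); last first.
  move=> /existsNP[i2 /not_implyP[i21 /existsNP[k2 /existsNP[l2]]]].
  move=> /not_implyP[k2u /not_implyP[jkl /eqP k2l2]] i x y xu yu.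
  have [ii1|ii1] := eqVneq i i1; last by apply: used_connected_other kl.
  by apply: used_connected_other jkl => //; rewrite ii1 eq_sym.
have [ii1|ii1] := eqVneq i i1; last by apply: used_connected_other kl.
exfalso; move=> {i x y xu yu ii1}.
have conn i : i != i1 -> {in used i &, forall k l, k = l}.
  move=> ii1 k l ku lu; apply: connect_trivial => //; first exact: triv.
  exact: used_connected_other kl.
have [j jk1 pj] := used_profile k1u.
have only (j' : profile S) : j' i1 = k1 -> 0 < p j' -> j' = j.
  move=> j'k1 pj'; apply/ffunP => i; have [->|ii1] := eqVneq i i1; first by rewrite j'k1.
  by apply: (conn i) => //; exact: mem_used.
pose q j' : R := (j' == j)%:R.
have regret_q i (k l : S i) : regret X q k l = (j i == k)%:R * (X i j - X i (upd j l)).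
  rewrite regretE (bigD1 j) //= /q eqxx mulr1 big1 ?addr0 // => j' /negPf->.
  by rewrite mulr0.
have tq : tight X a q.
  split=> [i k l|j']; last first.
    have [->|jj'] := eqVneq j' j; last by rewrite /q (negPf jj') mulr0.
    by move: pj; rewrite -gain_eq0 => /eqP ->; rewrite mul0r.
  rewrite regret_q; have [jk|] := eqVneq (j i) k; last by rewrite mul0r mulr0.
  rewrite mul1r; have [->|akl] := eqVneq (a i k l) 0; first by rewrite mul0r.
  have jkl : jump (a i) k l by rewrite /jump lt_neqAle eq_sym akl a_ge0.
  have [ii1|ii1] := eqVneq i i1; last first.
    rewrite -(triv i ii1 k l) //; last by rewrite -jk; exact: mem_used.
    by rewrite -jk upd_id subrr mulr0.
  have /eqP := p_tight.1 i k l; rewrite mulf_eq0 (negPf akl) /= /regret.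
  rewrite (bigD1 j) ?jk //= big1 ?addr0.
    by rewrite mulf_eq0 (gt_eqF pj) orbF => /eqP ->; rewrite mulr0.
  move=> j' /andP[/eqP j'k /eqP j'j]; subst i; rewrite jk1 in jk.
  apply/eqP; rewrite mulf_eq0; apply/orP; right; rewrite eq_le p_ge0 andbT leNgt.
  by apply/negP => /only pj'; apply: j'j; apply: pj'; rewrite j'k jk.
have /eqP := tight_flow_invariant G_generic tq i1 (upd j l1).
rewrite upd_same {1}/q (_ : (upd j l1 == j) = false); last first.
  by apply: contraNF k1l1 => /eqP jj;
    have := congr1 (fun j' : profile S => j' i1) jj; rewrite upd_same jk1 => ->.
rewrite mulr0 (bigD1 k1) //= upd_upd -jk1 upd_id {1}/q eqxx mulr1 lt_eqF //.
rewrite ltr_pwDl ?jk1 // sumr_ge0 // => k _.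
by rewrite mulr_ge0 // /q ler0n.
Qed.

Lemma unique_equilibrium i1 (k1 l1 : S i1) q :
  k1 \in used i1 -> k1 != l1 -> jump (a i1) k1 l1 ->
  (forall j, 0 <= q j) -> (forall j, ~~ box used j -> q j = 0) ->
  (forall i (k l : S i), k \in used i -> l \in used i -> 0 <= regret X q k l) ->
  exists c, forall j, q j = c * p j.
Proof.
move=> k1u k1l1 kl q0 qu qX; have conn := used_connected k1u k1l1 kl.
have tq : tight X a q.
  by apply: (@block_tight used) => // i; split=> // k l; exact: used_closed.
apply: (@stationary_unique _ _ (profile_rate a) _ _ [set j | box used j]).
- by move=> *; exact: profile_rate_ge0.
- exact: profile_rate_stationary (tight_flow_invariant G_generic tq).
- exact: profile_rate_stationary p_flow.
- by move=> j; rewrite inE box_used.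
- by move=> j; rewrite inE box_used => pj; apply/eqP; rewrite eq_le p_ge0 andbT leNgt.
- by move=> j; rewrite inE; exact: qu.
- by move=> j j'; rewrite !inE; exact: profile_rate_connect.
Qed.

(* Without jumps between distinct used strategies, an unused strategy is
   strictly dominated, against the used strategies of the opponents, along its
   outgoing jumps.  Hence a best deviation is a used strategy. *)
Lemma no_jump_regret_ge0 q :
  (forall i (k l : S i), k \in used i -> jump (a i) k l -> k = l) ->
  (forall j, 0 <= q j) -> (forall j, ~~ box used j -> q j = 0) ->
  (forall i (k l : S i), k \in used i -> l \in used i -> 0 <= regret X q k l) ->
  forall i (k l : S i), 0 <= regret X q k l.
Proof.
move=> triv q0 qu qX i k l; have [ku|ku] := boolP (k \in used i); last first.
  rewrite /regret big1 // => j /eqP jk; rewrite qu ?mulr0 //.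
  by apply/forallPn; exists i; rewrite jk.
have [l0 _ lmin] := @arg_minP _ _ _ l xpredT (fun l => regret X q k l) isT.
apply: le_trans (lmin l isT); have [l0u|l0u] := boolP (l0 \in used i); first exact: qX.
have gainE j : box used j -> gain X a (upd j l0) =
    \sum_l a i l0 l * (X i (upd j l0) - X i (upd j l)).
  move=> /forallP ju; rewrite /gain (bigD1 i) //= upd_same [X in _ + X]big1 ?addr0.
    by apply: eq_bigr => l' _; rewrite upd_upd.
  move=> i' ii'; rewrite big1 // => l' _; rewrite upd_other //.
  have [jl'|] := boolP (jump (a i') (j i') l'); last by move/a_eq0 ->; rewrite mul0r.
  by rewrite -(triv _ _ _ (ju i') jl') -{3}(upd_other j l0 ii') upd_id subrr mulr0.
have sumE : \sum_l a i l0 l * (regret X q k l - regret X q k l0) =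
    \sum_(j : profile S | j i == k) gain X a (upd j l0) * q j.
  transitivity (\sum_l \sum_(j : profile S | j i == k)
      (a i l0 l * (X i (upd j l0) - X i (upd j l))) * q j).
    apply: eq_bigr => l' _; rewrite /regret -sumrB mulr_sumr.
    by apply: eq_bigr => j _; ring.
  rewrite exchange_big; apply: eq_bigr => j _; rewrite -mulr_suml.
  have [ju|ju] := boolP (box used j); first by rewrite gainE.
  by rewrite qu ?mulr0.
have : 0 <= \sum_(j : profile S | j i == k) gain X a (upd j l0) * q j.
  rewrite -sumE; apply: sumr_ge0 => l' _; rewrite mulr_ge0 // subr_ge0.
  exact: lmin.
rewrite -oppr_le0 -sumrN => s0; rewrite /regret big1 // => j jk.
apply/eqP; rewrite mulf_eq0; apply/orP; right.
have gl : gain X a (upd j l0) < 0.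
  case: (gain_lt0 (upd j l0)) => //; rewrite -box_used => /forallP/(_ i).
  by rewrite upd_same (negPf l0u).
rewrite eq_le q0 andbT; have := le_trans _ s0.
move=> /(_ (- (gain X a (upd j l0) * q j))); rewrite -mulNr pmulr_rle0 ?oppr_gt0 //.
apply; rewrite (bigD1 j) //= mulNr lerDl sumr_ge0 // => j' _.
by rewrite -mulNr mulr_ge0 // oppr_ge0.
Qed.

Lemma equilibrium_box (q : tensor G) : correlated_equilibria G q ->
  forall j, ~~ box used j -> q j = 0.
Proof.
move=> /equilibriumP[q0 _ qX] j; rewrite box_used -gain_eq0 => gj.
have [_ /(_ j)/eqP] : tight X a (q : profile S -> R).
  apply: complementary => [i k l|j']; first by rewrite mulr_ge0 ?qX.
  by rewrite mulr_le0_ge0.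
by rewrite mulf_eq0 (negPf gj) => /eqP.
Qed.

Definition normalized : tensor G := [ffun j => (\sum_j p j)^-1 * p j].

Lemma normalized_gt0 j : (0 < (normalized j : R)) = (0 < p j).
Proof. by rewrite ffunE pmulr_rgt0 ?invr_gt0. Qed.

Lemma regret_normalized i (k l : S i) :
  regret X (normalized : profile S -> R) k l = (\sum_j p j)^-1 * regret X p k l.
Proof. by rewrite -regretZ; apply: eq_regret => j; rewrite ffunE. Qed.

Lemma normalized_equilibrium : correlated_equilibria G normalized.
Proof.
have s0 : 0 <= (\sum_j p j)^-1 by rewrite invr_ge0 ltW.
apply/equilibriumP; split=> [j||i k l].
- by rewrite ffunE mulr_ge0.
- under eq_bigr do rewrite ffunE.
  by rewrite -mulr_sumr mulVf // gt_eqF.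
- by rewrite regret_normalized mulr_ge0.
Qed.

(** An equality of families, so that it can be rewritten inside the type depending on [subgame]. By
    [equilibrium_box], no equilibrium charges strategies that [p] does not. *)
Lemma ce_strategiesE : @ce_strategies R G = used.
Proof.
apply: functional_extensionality_dep => i; apply/setP => k.
rewrite inE; apply/asboolP/idP => [[q Pq /eqP qk]|ku].
  have [o qo] : exists o, slice q k o != 0.
    apply/not_existsP => N; apply: qk; apply/ffunP => o.
    by rewrite [RHS]ffunE; apply/eqP/negPn/negP/N.
  rewrite ffunE in qo; rewrite -(glue_same k o); apply: mem_used.
  rewrite -box_used; apply: contraNT qo => jb.
  by rewrite (equilibrium_box Pq jb).
have [j <- pj] := used_profile ku; exists normalized; first exact: normalized_equilibrium.
apply/eqP => /ffunP/(_ [ffun i' => j (val i')]) /eqP; rewrite [slice _ _ _]ffunE [_ 0 _]ffunE.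
have -> : Defs.glue (j i) [ffun i' => j (val i')] = j.
  by apply/eqP; rewrite glue_eq !eqxx.
by rewrite gt_eqF // normalized_gt0.
Qed.

Let G' := subgame used_neq0.

Lemma jump_cases : (forall i (k l : S i), k \in used i -> jump (a i) k l -> k = l) \/
  exists i (k l : S i), [/\ k \in used i, k != l & jump (a i) k l].
Proof.
have [|N] := pselect (exists i (k l : S i), [/\ k \in used i, k != l & jump (a i) k l]).
  by right.
left=> i k l ku kl; apply/eqP/negPn/negP => kNl; apply: N.
by exists i, k, l.
Qed.

Lemma extend_regret_ge0 (q : tensor G') : correlated_equilibria G' q ->
  forall i (k l : S i), k \in used i -> l \in used i ->
  0 <= regret X (extend (q : profile (@sub_strategy R G used) -> R)) k l.
Proof.
move=> /equilibriumP[_ _ qX] i k l ku lu.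
have := qX i (Sub k ku) (Sub l lu).
by rewrite -(regret_extend used_neq0) !SubK.
Qed.

Lemma extend_unique (q : tensor G') i1 (k1 l1 : S i1) :
  k1 \in used i1 -> k1 != l1 -> jump (a i1) k1 l1 -> correlated_equilibria G' q ->
  [ffun j => extend (q : profile (@sub_strategy R G used) -> R) j] = normalized.
Proof.
move=> k1u k1l1 kl Pq; have [q0 q1 _] := (equilibriumP _).1 Pq.
have [|||c qc] := @unique_equilibrium i1 k1 l1
   (extend (q : profile (@sub_strategy R G used) -> R)) k1u k1l1 kl.
- by move=> j; exact: extend_ge0.
- exact: extend_box.
- exact: extend_regret_ge0.
have c1 : c * \sum_j p j = 1.
  by rewrite mulr_sumr -(eq_bigr _ (fun j _ => qc j)) sum_extend; exact: q1.
apply/ffunP => j; rewrite !ffunE qc; congr (_ * _).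
by apply: (mulIf (lt0r_neq0 p_gt0)); rewrite c1 mulVf // gt_eqF.
Qed.

Lemma extend_equilibrium (q : tensor G') : correlated_equilibria G' q ->
  correlated_equilibria G [ffun j => extend (q : profile (@sub_strategy R G used) -> R) j].
Proof.
move=> Pq; have [triv|[i1 [k1 [l1 [k1u k1l1 kl]]]]] := jump_cases; last first.
  by rewrite (extend_unique k1u k1l1 kl Pq); exact: normalized_equilibrium.
have [q0 q1 _] := (equilibriumP _).1 Pq; apply/equilibriumP; split.
- by move=> j; rewrite ffunE extend_ge0.
- by under eq_bigr do rewrite ffunE; rewrite sum_extend.
- move=> i k l; rewrite (eq_regret _ _ _ (ffunE _)); apply: no_jump_regret_ge0 => //.
  + by move=> j; exact: extend_ge0.
  + exact: extend_box.
  + exact: extend_regret_ge0.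
Qed.

Lemma subgame_dichotomy :
  full_dimensional G' \/ singleton_set (correlated_equilibria G').
Proof.
have Pn := restrict_equilibrium used_neq0 normalized_equilibrium
  (equilibrium_box normalized_equilibrium).
have [triv|[i1 [k1 [l1 [k1u k1l1 kl]]]]] := jump_cases; [left|right].
  apply: (slack_full_dimensional Pn) => [j'|i k l kl].
    rewrite ffunE normalized_gt0 -box_used; apply/forallP => i.
    by rewrite ffunE (valP (j' i)).
  rewrite (eq_regret _ _ _ (ffunE _)).
  rewrite -(regret_sub_profile used_neq0 (q := normalized)); last first.
    exact: equilibrium_box normalized_equilibrium.
  rewrite regret_normalized mulr_gt0 ?invr_gt0 //.
  case: (a_gt0 (val k) (val l)) => // jkl.
  by move: kl; rewrite -(inj_eq val_inj) (triv _ _ _ (valP k) jkl) eqxx.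
exists (restrict used_neq0 normalized); apply/seteqP; split=> [q Pq|_ ->] //=.
rewrite -(extend_unique k1u k1l1 kl Pq); apply/ffunP => j'.
by rewrite !ffunE extend_sub_profile.
Qed.

Lemma strictly_complementary_subgame :
  exists Sc_neq0 : forall i, @ce_strategies R G i != finset.set0,
    let G' := subgame Sc_neq0 in
    affinely_isomorphic (correlated_equilibria G) (correlated_equilibria G') /\
    (full_dimensional G' \/ singleton_set (correlated_equilibria G')).
Proof.
rewrite ce_strategiesE; exists used_neq0; split; last exact: subgame_dichotomy.
apply: restrict_isomorphism; first exact: equilibrium_box.
exact: extend_equilibrium.
Qed.

End StrictlyComplementary.

Theorem theorem3p13 (R : realType) (G : game R)
    (strategy_ge2 : forall i : 'I_(nplayers G), (2 <= #|strategy G i|)%N)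
    (G_generic : generic G) :
  exists Sc_neq0 : forall i : 'I_(nplayers G), ce_strategies i != finset.set0,
    let G' := subgame Sc_neq0 in
    affinely_isomorphic (correlated_equilibria G) (correlated_equilibria G') /\
    (full_dimensional G' \/ singleton_set (correlated_equilibria G')).
Proof.
have [p [a [[p0 ps pX] [a0 ga ap gp]]]] :=
  strict_complementarity (payoff G) (@strategy_gt0 R G).
exact: (strictly_complementary_subgame G_generic p0 ps pX a0 ga ap gp).
Qed.
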